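(* Let $X$ be a complex manifold, $\pi:E\to X$ a holomorphic vector bundle, $\mathcal U=\{U_i\}_{i\in I}$ an open cover of $X$ ($I$ an ordered set), and $g=\{g_{ij}\}$ a system of transition functions associated with a certain trivialization of $E$ with respect to $\mathcal U$. For indices $i_1,i_2\in I$ define $t_{i_1i_2}\in\Gamma(U_{i_1i_2},\Omega^1)$ by $$t_{i_1i_2}:=\sum_{\sigma\in S_2}\frac{\mathrm{sgn}(\sigma)}{2!}\,\mathrm{tr}\big(g^{-1}_{i_{\sigma(1)}i_{\sigma(2)}}dg_{i_{\sigma(1)}i_{\sigma(2)}}\big)=\mathrm{tr}\big(g^{-1}_{i_1i_2}dg_{i_1i_2}\big),$$ and define the Čech $1$-cochain $\widehat f^r_{1,\mathcal U}(E):=(t_{i_1i_2})_{i_1<i_2}$ with $t_{i_1i_2}\in\Gamma(U_{i_1i_2},d\Omega^0)$. Then $\widehat f^r_{1,\mathcal U}(E)$ is a Čech $1$-cocycle with coefficients in $d\Omega^0$ and hence defines an element $f^r_{1,\mathcal U}(E)\in\check H^1(\mathcal U,d\Omega^0)$; moreover, $f^r_{1,\mathcal U}(E)$ is independent of the choice of $g$. Denote by $f^r_1(E)$ the image of $f^r_{1,\mathcal U}(E)$ in $\check H^1(X,d\Omega^0)$ under the canonical homomorphism; then $f^r_1(E)$ is independent of the choice of $\mathcal U$.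
   Context: $\Omega^k$ is the sheaf of germs of holomorphic $k$-forms on $X$, and $d\Omega^0$ is the sheaf (of $\mathbb C$-vector spaces) of germs of $d$-closed holomorphic $1$-forms. A trivialization of $E$ (rank $M$) with respect to $\mathcal U$ is a family of holomorphic bundle isomorphisms $\phi_i:E|_{U_i}\to U_i\times\mathbb C^M$; its transition functions are the holomorphic maps $g_{ij}:U_i\cap U_j\to GL(M,\mathbb C)$ with $\phi_i\circ\phi_j^{-1}(z,v)=(z,g_{ij}(z)v)$. $dg_{ij}$ is the entrywise differential. $U_{i_1i_2}=U_{i_1}\cap U_{i_2}$. Čech $k$-cochains are families of sections indexed by $i_1<\cdots<i_{k+1}$ with differential $(\partial s)_{i_1\cdots i_{k+2}}=\sum_j(-1)^{j+1}s_{i_1\cdots\widehat{i_j}\cdots i_{k+2}}$; $\check H^k(\mathcal U,\cdot)$ is the resulting cohomology and $\check H^k(X,\cdot)=\varinjlim_{\mathcal U}\check H^k(\mathcal U,\cdot)$ over open covers under refinement. $f_1^r(E)$ is called the refined first $T$ invariant of $E$. *)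

(* Defs.v *)
From HB Require Import structures.
From mathcomp Require Import all_boot all_order all_algebra all_fingroup.
From mathcomp Require Import generic_quotient ring_quotient.
From mathcomp Require Import all_classical all_reals all_analysis.
From mathcomp Require Import complex.

Set Implicit Arguments.
Unset Strict Implicit.
Unset Printing Implicit Defensive.

Import numFieldNormedType.Exports.
Import Order.TTheory GRing.Theory Num.Theory.

Local Open Scope classical_set_scope.
Local Open Scope ring_scope.
Local Open Scope complex_scope.
Local Open Scope quotient_scope.

(* R[i] as a normed space over itself. Hence [differentiable f z], for f
   between spaces of complex matrices, is complex (Frechet) differentiability,
   and f is holomorphic on an open set iff it is differentiable at each of its
   points. *)
HB.instance Definition _ (R : realType) := NormedModule.copy R[i] R[i]^o.

Record opens (X : topologicalType) := Opens {
  oset :> set X;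
  oset_open : open oset }.

Definition oI (X : topologicalType) (V W : opens X) : opens X :=
  Opens (openI (oset_open V) (oset_open W)).

Definition ole (X : topologicalType) (V W : opens X) : Prop := V `<=` W.

Section OpensTheory.
Variable X : topologicalType.
Implicit Types U V W : opens X.

Lemma ole_refl V : ole V V. Proof. by []. Qed.
Lemma ole_trans V U W : ole U V -> ole V W -> ole U W.
Proof. exact: subset_trans. Qed.
Lemma oleIl V W : ole (oI V W) V. Proof. by move=> x []. Qed.
Lemma oleIr V W : ole (oI V W) W. Proof. by move=> x []. Qed.
Lemma oleI U V W : ole U V -> ole U W -> ole U (oI V W).
Proof. by move=> h k x Ux; split; [exact: h | exact: k]. Qed.
Lemma oleII U U' V V' : ole U V -> ole U' V' -> ole (oI U U') (oI V V').
Proof. by move=> h k x [Ux Ux']; split; [exact: h | exact: k]. Qed.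
Lemma oleC V W : ole (oI V W) (oI W V). Proof. by move=> x []. Qed.

End OpensTheory.
Arguments ole_refl {X} V.
Arguments ole_trans {X V U W}.
Arguments oleIl {X} V W.
Arguments oleIr {X} V W.
Arguments oleI {X U V W}.
Arguments oleII {X U U' V V'}.
Arguments oleC {X} V W.

Record presheaf (X : topologicalType) := Presheaf {
  sec :> opens X -> zmodType;
  res : forall V W : opens X, ole V W -> {additive sec W -> sec V};
  res_id : forall (V : opens X) (h : ole V V) (s : sec V), res h s = s;
  res_comp : forall (U V W : opens X) (h : ole U V) (k : ole V W)
    (l : ole U W) (s : sec W), res h (res k s) = res l s }.

Arguments res {X p V W} h.
Arguments res_id {X p V} h s.
Arguments res_comp {X p U V W} h k l s.

Lemma res_irr (X : topologicalType) (F : presheaf X) (V W : opens X)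
  (h k : ole V W) (s : F W) : res h s = res k s.
Proof. by rewrite (Prop_irrelevance h k). Qed.
Arguments res_irr {X F V W} h k s.

(* The index set is totally ordered by [clt]. It is not an [orderType] because
   the covers of [X], which index a direct limit below, must form a type in the
   universe of [choiceType]. *)
Record open_cover (X : topologicalType) := Cover {
  cidx : Type;
  clt : cidx -> cidx -> bool;
  cltxx : forall i, clt i i = false;
  clt_trans : forall j i k, clt i j -> clt j k -> clt i k;
  clt_total : forall i j, [\/ clt i j, clt j i | i = j];
  cset :> cidx -> opens X;
  ccover : forall x, exists i, (cset i : set X) x }.
Arguments clt {X o} i j.
Arguments clt_trans {X o} [j i k].

Definition dprod (T : Type) (V : T -> zmodType) : Type := forall t, V t.

Section DProd.
Variables (T : Type) (V : T -> zmodType).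

HB.instance Definition _ := Choice.on (dprod V).

Let zero : dprod V := fun t => 0.
Let opp (s : dprod V) : dprod V := fun t => - s t.
Let add (s u : dprod V) : dprod V := fun t => s t + u t.

Let addA : associative add.
Proof. by move=> s u v; apply: functional_extensionality_dep => t; exact: addrA. Qed.
Let addC : commutative add.
Proof. by move=> s u; apply: functional_extensionality_dep => t; exact: addrC. Qed.
Let add0 : left_id zero add.
Proof. by move=> s; apply: functional_extensionality_dep => t; exact: add0r. Qed.
Let addN : left_inverse zero opp add.
Proof. by move=> s; apply: functional_extensionality_dep => t; exact: addNr. Qed.

HB.instance Definition _ := GRing.isZmodule.Build (dprod V) addA addC add0 addN.

Lemma dprodBE (s u : dprod V) t : (s - u) t = s t - u t. Proof. by []. Qed.
End DProd.

Section Cech.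
Variables (X : topologicalType) (F : presheaf X).

Section Cochains.
Variable U : open_cover X.
Implicit Types i j k : cidx U.

Definition cech0 : zmodType := dprod (fun i => F (U i)).
Definition cech1 : zmodType :=
  dprod (fun i => dprod (fun j => dprod (fun _ : clt i j =>
    F (oI (U i) (U j))))).
Definition cech2 : zmodType :=
  dprod (fun i => dprod (fun j => dprod (fun k =>
    dprod (fun _ : clt i j => dprod (fun _ : clt j k =>
      F (oI (oI (U i) (U j)) (U k))))))).

Definition del0 (s : cech0) : cech1 :=
  fun i j _ => res (oleIr (U i) (U j)) (s j) - res (oleIl (U i) (U j)) (s i).

Definition del1 (s : cech1) : cech2 :=
  fun i j k ij jk =>
      res (oleII (oleIr (U i) (U j)) (ole_refl (U k))) (s j k jk)
    - res (oleII (oleIl (U i) (U j)) (ole_refl (U k)))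
        (s i k (clt_trans ij jk))
    + res (oleIl (oI (U i) (U j)) (U k)) (s i j ij).


Lemma del0_is_zmod_morphism : zmod_morphism del0.
Proof.
move=> s t; do 3!apply: functional_extensionality_dep => ?.
rewrite !dprodBE /del0 !dprodBE !raddfB /=.
by rewrite ?opprD ?opprK addrACA.
Qed.
HB.instance Definition _ :=
  GRing.isZmodMorphism.Build _ _ del0 del0_is_zmod_morphism.

Lemma del1_is_zmod_morphism : zmod_morphism del1.
Proof.
move=> s t; do 5!apply: functional_extensionality_dep => ?.
rewrite !dprodBE /del1 !dprodBE !raddfB /=.
by rewrite ?opprD ?opprK [RHS]addrACA; congr (_ + _); rewrite addrACA.
Qed.
HB.instance Definition _ :=
  GRing.isZmodMorphism.Build _ _ del1 del1_is_zmod_morphism.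

Definition is_cocycle1 : {pred cech1} := [pred s | del1 s == 0].

Lemma is_cocycle1_zmod_closed : zmod_closed is_cocycle1.
Proof.
split=> [|s t]; rewrite !unfold_in /= ?raddf0 //.
by move=> /eqP hs /eqP ht; rewrite raddfB /= hs ht subrr.
Qed.
HB.instance Definition _ :=
  GRing.isZmodClosed.Build _ is_cocycle1 is_cocycle1_zmod_closed.

Record cocycle1 := Cocycle1 { cochain1 : cech1; _ : cochain1 \in is_cocycle1 }.
HB.instance Definition _ := [isSub for cochain1].
HB.instance Definition _ := [Choice of cocycle1 by <:].
HB.instance Definition _ := [SubChoice_isSubZmodule of cocycle1 by <:].

Definition is_coboundary1 : {pred cocycle1} :=
  fun z => `[< exists t : cech0, cochain1 z = del0 t >].

Lemma is_coboundary1_zmod_closed : zmod_closed is_coboundary1.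
Proof.
split=> [|s t]; rewrite !unfold_in.
  by apply/asboolP; exists 0; rewrite [RHS]raddf0.
move=> /asboolP[u su] /asboolP[v tv]; apply/asboolP.
by exists (u - v); rewrite [RHS]raddfB /= -su -tv.
Qed.
HB.instance Definition _ :=
  GRing.isZmodClosed.Build _ is_coboundary1 is_coboundary1_zmod_closed.

Definition cechH1 : zmodType := Quotient.quot is_coboundary1.
Definition cech_class (z : cocycle1) : cechH1 :=
  \pi_(Quotient.quot is_coboundary1) z.

Lemma cech_class_is_zmod_morphism : zmod_morphism cech_class.
Proof. by move=> s t; rewrite /cech_class raddfB. Qed.
HB.instance Definition _ :=
  GRing.isZmodMorphism.Build _ _ cech_class cech_class_is_zmod_morphism.

Lemma cech_classP (z z' : cocycle1) :
  cech_class z = cech_class z' <->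
  exists t : cech0, cochain1 z - cochain1 z' = del0 t.
Proof.
rewrite /cech_class; split=> [/eqP|[t zt]].
  by rewrite -Quotient.idealrBE => /asboolP[t zt]; exists t.
by apply/eqP; rewrite -Quotient.idealrBE; apply/asboolP; exists t.
Qed.

Lemma cech_class_surj (a : cechH1) : exists z, a = cech_class z.
Proof. by exists (repr a); rewrite /cech_class reprK. Qed.

Lemma cocycle1P (s : cocycle1) : del1 (cochain1 s) = 0.
Proof. by case: s => s /= /eqP. Qed.

Definition alt (s : cech1) i j : F (oI (U i) (U j)) :=
  match boolP (clt i j) with
  | AltTrue ij => s i j ij
  | AltFalse _ =>
    match boolP (clt j i) with
    | AltTrue ji => - res (oleC (U i) (U j)) (s j i ji)
    | AltFalse _ => 0
    end
  end.

Definition altr (s : cech1) (W : opens X) i j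
    (hi : ole W (U i)) (hj : ole W (U j)) : F W :=
  res (oleI hi hj) (alt s i j).

Lemma alt_lt s i j (ij : clt i j) : alt s i j = s i j ij.
Proof.
rewrite /alt; destruct (boolP (clt i j)) as [h|h]; last by rewrite ij in h.
by congr (s i j _); exact: bool_irrelevance.
Qed.

Lemma alt_gt s i j (ji : clt j i) :
  alt s i j = - res (oleC (U i) (U j)) (s j i ji).
Proof.
rewrite /alt; destruct (boolP (clt i j)) as [h|h].
  by have := clt_trans h ji; rewrite cltxx.
destruct (boolP (clt j i)) as [k|k]; last by rewrite ji in k.
by congr (- res _ (s j i _)); exact: bool_irrelevance.
Qed.

Lemma alt_refl s i : alt s i i = 0.
Proof.
rewrite /alt; destruct (boolP (clt i i)) as [h|h]; by [exfalso; rewrite cltxx in h|].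
Qed.

Lemma altr_irr s W i j (hi hi' : ole W (U i)) (hj hj' : ole W (U j)) :
  altr s hi hj = altr s hi' hj'.
Proof. by rewrite (Prop_irrelevance hi hi') (Prop_irrelevance hj hj'). Qed.

Lemma altr_anti s W i j (hi : ole W (U i)) (hj : ole W (U j)) :
  altr s hi hj = - altr s hj hi.
Proof.
rewrite /altr; case: (clt_total i j) => [ij|ji|ij].
- rewrite (alt_lt _ ij) (alt_gt _ ij) !raddfN opprK.
  by rewrite (res_comp _ _ (oleI hi hj)).
- rewrite (alt_lt _ ji) (alt_gt _ ji) !raddfN /=.
  by rewrite (res_comp _ _ (oleI hj hi)).
- by subst j; rewrite alt_refl (raddf0 (res (oleI hi hj)))
    (raddf0 (res (oleI hj hi))) oppr0.
Qed.

Lemma altr_refl s W i (hi hi' : ole W (U i)) : altr s hi hi' = 0.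
Proof. by rewrite /altr alt_refl raddf0. Qed.

Lemma altr_cocycle_lt (z : cocycle1) W i j k
    (hi : ole W (U i)) (hj : ole W (U j)) (hk : ole W (U k)) :
  clt i j -> clt j k ->
  altr (cochain1 z) hi hj + altr (cochain1 z) hj hk = altr (cochain1 z) hi hk.
Proof.
move=> ij jk; rewrite /altr (alt_lt _ ij) (alt_lt _ jk) (alt_lt _ (clt_trans ij jk)).
have := cocycle1P z.
move=> /(congr1 (fun s : cech2 => res (oleI (oleI hi hj) hk) (s i j k ij jk))).
rewrite /del1 raddf0 raddfD raddfB /=.
rewrite (res_comp _ _ (oleI hj hk)) (res_comp _ _ (oleI hi hk)).
rewrite (res_comp _ _ (oleI hi hj)) => /eqP.
by rewrite addrAC subr_eq0 addrC => /eqP.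
Qed.

Lemma altr_cocycle (z : cocycle1) W i j k
    (hi : ole W (U i)) (hj : ole W (U j)) (hk : ole W (U k)) :
  altr (cochain1 z) hi hj + altr (cochain1 z) hj hk = altr (cochain1 z) hi hk.
Proof.
set s := cochain1 z.
have [ij|ji|?] := clt_total i j; last first.
- by subst j; rewrite altr_refl add0r; exact: altr_irr.
- have [jk|kj|?] := clt_total j k; last first.
  + by subst k; rewrite altr_refl addr0; exact: altr_irr.
  + rewrite (altr_anti s hi hj) (altr_anti s hj hk) (altr_anti s hi hk).
    by rewrite -opprD addrC (altr_cocycle_lt z hk hj hi kj ji).
  + have [ik|ki|?] := clt_total i k; last first.
    * by subst k; rewrite altr_refl (altr_anti s hi hj) (altr_irr s hj hj hk hi) addNr.
    * rewrite (altr_anti s hi hj) -(altr_cocycle_lt z hj hk hi jk ki) opprD.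
      by rewrite addrAC addNr add0r -altr_anti.
    * by rewrite (altr_anti s hi hj) -(altr_cocycle_lt z hj hi hk ji ik) addKr.
- have [jk|kj|?] := clt_total j k; last first.
  + by subst k; rewrite altr_refl addr0; exact: altr_irr.
  + have [ik|ki|?] := clt_total i k; last first.
    * by subst k; rewrite altr_refl (altr_anti s hi hj) (altr_irr s hj hj hk hi) addNr.
    * rewrite (altr_anti s hi hk) (altr_anti s hj hk).
      by rewrite -(altr_cocycle_lt z hk hi hj ki ij) opprD addrCA subrr addr0.
    * rewrite -(altr_cocycle_lt z hi hk hj ik kj) (altr_anti s hj hk).
      by rewrite addrK.
  + exact: altr_cocycle_lt.
Qed.

End Cochains.

Record refinement (V U : open_cover X) := Refinement {
  rmap :> cidx V -> cidx U;
  rmapP : forall j, ole (V j) (U (rmap j)) }.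

Arguments rmapP {V U} r j.

Definition refine_id (U : open_cover X) : refinement U U :=
  Refinement (fun i => ole_refl (U i)).

Definition refine_comp (W V U : open_cover X) (s : refinement W V)
    (t : refinement V U) : refinement W U :=
  Refinement (fun i => ole_trans (rmapP s i) (rmapP t (s i))).

Section Refine.
Variables (V U : open_cover X) (t : refinement V U).

(* A refinement map need not be increasing, whence the alternating extension. *)
Definition refine1 (s : cech1 U) : cech1 V :=
  fun i j _ => res (oleII (rmapP t i) (rmapP t j)) (alt s (t i) (t j)).

Lemma refine1E (s : cech1 U) i j (ij : clt i j)
    (hi : ole (oI (V i) (V j)) (U (t i))) (hj : ole (oI (V i) (V j)) (U (t j))) :
  refine1 s ij = altr s hi hj.
Proof. by rewrite /refine1 /altr; congr (res _ _); exact: Prop_irrelevance. Qed.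

Lemma alt_is_zmod_morphism i j :
  zmod_morphism (fun s : cech1 U => alt s i j).
Proof.
move=> s u; case: (clt_total i j) => [ij|ji|ij].
- by rewrite !(alt_lt _ ij) !dprodBE.
- by rewrite !(alt_gt _ ji) !dprodBE raddfB /= opprD.
- by subst j; rewrite !alt_refl subrr.
Qed.

Lemma refine1_is_zmod_morphism : zmod_morphism refine1.
Proof.
move=> s u; do 3!apply: functional_extensionality_dep => ?.
by rewrite !dprodBE /refine1 alt_is_zmod_morphism raddfB.
Qed.
HB.instance Definition _ :=
  GRing.isZmodMorphism.Build _ _ refine1 refine1_is_zmod_morphism.

Lemma altr_refine1 (z : cocycle1 U) W i j (hi : ole W (V i)) (hj : ole W (V j)) :
  altr (refine1 (cochain1 z)) hi hj =
  altr (cochain1 z) (ole_trans hi (rmapP t i)) (ole_trans hj (rmapP t j)).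
Proof.
have lt_case a b (ha : ole W (V a)) (hb : ole W (V b)) : clt a b ->
    altr (refine1 (cochain1 z)) ha hb =
    altr (cochain1 z) (ole_trans ha (rmapP t a)) (ole_trans hb (rmapP t b)).
  move=> ab; rewrite /altr (alt_lt _ ab) /refine1.
  by rewrite (res_comp _ _ (oleI (ole_trans ha (rmapP t a))
                                 (ole_trans hb (rmapP t b)))).
case: (clt_total i j) => [ij|ji|ij]; first exact: lt_case.
  by rewrite altr_anti lt_case // -altr_anti.
by subst j; rewrite altr_refl (altr_refl (cochain1 z)).
Qed.

Lemma refine1_cocycle (z : cocycle1 U) :
  refine1 (cochain1 z) \in @is_cocycle1 V.
Proof.
rewrite unfold_in /=; apply/eqP.
apply: functional_extensionality_dep => i.
apply: functional_extensionality_dep => j.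
apply: functional_extensionality_dep => k.
apply: functional_extensionality_dep => ij.
apply: functional_extensionality_dep => jk.
set W := oI (oI (V i) (V j)) (V k).
have hi : ole W (V i) by move=> x [[]].
have hj : ole W (V j) by move=> x [[]].
have hk : ole W (V k) by move=> x [].
have E := altr_cocycle z (ole_trans hi (rmapP t i)) (ole_trans hj (rmapP t j))
  (ole_trans hk (rmapP t k)).
rewrite -!altr_refine1 /altr (alt_lt _ ij) (alt_lt _ jk)
  (alt_lt _ (clt_trans ij jk)) in E.
rewrite /del1 (res_irr _ (oleI hj hk)) (res_irr _ (oleI hi hk)).
rewrite (res_irr (oleIl _ _) (oleI hi hj)).
by apply/eqP; rewrite addrAC subr_eq0 addrC; apply/eqP.
Qed.

Definition refineZ (z : cocycle1 U) : cocycle1 V :=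
  Cocycle1 (refine1_cocycle z).

Definition refine0 (s : cech0 U) : cech0 V := fun j => res (rmapP t j) (s (t j)).

Lemma alt_del0 (s : cech0 U) i j :
  alt (del0 s) i j =
  res (oleIr (U i) (U j)) (s j) - res (oleIl (U i) (U j)) (s i).
Proof.
case: (clt_total i j) => [ij|ji|ij]; first by rewrite (alt_lt _ ij).
  rewrite (alt_gt _ ji) /del0 raddfB opprB /=.
  by rewrite (res_comp _ _ (oleIl _ _)) (res_comp _ _ (oleIr _ _)).
by subst j; rewrite alt_refl (Prop_irrelevance (oleIl _ _) (oleIr _ _)) subrr.
Qed.

Lemma refine1_del0 (s : cech0 U) : refine1 (del0 s) = del0 (refine0 s).
Proof.
apply: functional_extensionality_dep => i.
apply: functional_extensionality_dep => j.
apply: functional_extensionality_dep => ij.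
rewrite /refine1 alt_del0 raddfB /= /del0 /refine0.
have hi : ole (oI (V i) (V j)) (U (t i)) := ole_trans (oleIl _ _) (rmapP t i).
have hj : ole (oI (V i) (V j)) (U (t j)) := ole_trans (oleIr _ _) (rmapP t j).
by rewrite !(res_comp _ _ hi) !(res_comp _ _ hj).
Qed.

Definition refineH1 (a : cechH1 U) : cechH1 V := cech_class (refineZ (repr a)).

Lemma refineH1E (z : cocycle1 U) :
  refineH1 (cech_class z) = cech_class (refineZ z).
Proof.
have /cech_classP[u zu] : cech_class (repr (cech_class z)) = cech_class z.
  by rewrite /cech_class reprK.
by apply/cech_classP; exists (refine0 u); rewrite -refine1_del0 -zu raddfB.
Qed.

Lemma refineH1_is_zmod_morphism : zmod_morphism refineH1.
Proof.
move=> a b; have [z ->] := cech_class_surj a; have [w ->] := cech_class_surj b.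
rewrite -raddfB !refineH1E -raddfB; congr cech_class.
by apply: val_inj; rewrite /= raddfB.
Qed.
HB.instance Definition _ :=
  GRing.isZmodMorphism.Build _ _ refineH1 refineH1_is_zmod_morphism.

End Refine.
Arguments refine1E {V U} t s {i j} ij hi hj.

Let zmod_swap (A : zmodType) (a b c d : A) : d + a = b + c -> a - b = c - d.
Proof. by move=> E; rewrite -[a](addKr d) E [b + c]addrC addrA addrK addrC. Qed.

Lemma refineH1_indep (V U : open_cover X) (t t' : refinement V U) :
  refineH1 t =1 refineH1 t'.
Proof.
move=> a; have [z ->] := cech_class_surj a; rewrite !refineH1E.
apply/cech_classP.
exists (fun j => altr (cochain1 z) (rmapP t' j) (rmapP t j)).
apply: functional_extensionality_dep => i.
apply: functional_extensionality_dep => j.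
apply: functional_extensionality_dep => ij.
rewrite !dprodBE /=.
have hi : ole (oI (V i) (V j)) (U (t i)) := ole_trans (oleIl _ _) (rmapP t i).
have hj : ole (oI (V i) (V j)) (U (t j)) := ole_trans (oleIr _ _) (rmapP t j).
have hi' : ole (oI (V i) (V j)) (U (t' i)) := ole_trans (oleIl _ _) (rmapP t' i).
have hj' : ole (oI (V i) (V j)) (U (t' j)) := ole_trans (oleIr _ _) (rmapP t' j).
rewrite (refine1E _ _ ij hi hj) (refine1E _ _ ij hi' hj') /del0.
rewrite [in X in _ = X - _]/altr [in X in _ = _ - X]/altr.
rewrite (res_comp _ _ (oleI hj' hj)) (res_comp _ _ (oleI hi' hi)).
rewrite -/(altr (cochain1 z) hj' hj) -/(altr (cochain1 z) hi' hi).
by apply: zmod_swap; rewrite !altr_cocycle.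
Qed.

Lemma refineH1_id (U : open_cover X) (t : refinement U U) : refineH1 t =1 id.
Proof.
move=> a; rewrite (refineH1_indep t (refine_id U)).
have [z ->] := cech_class_surj a; rewrite refineH1E; congr cech_class.
apply: val_inj; apply: functional_extensionality_dep => i.
apply: functional_extensionality_dep => j.
apply: functional_extensionality_dep => ij.
by rewrite /= /refine1 (alt_lt _ ij) res_id.
Qed.

Lemma refineH1_comp (W V U : open_cover X) (s : refinement W V) (t : refinement V U)
  (r : refinement W U) a : refineH1 s (refineH1 t a) = refineH1 r a.
Proof.
rewrite (refineH1_indep r (refine_comp s t)).
have [z ->] := cech_class_surj a; rewrite !refineH1E; congr cech_class.
apply: val_inj; apply: functional_extensionality_dep => i.
apply: functional_extensionality_dep => j.
apply: functional_extensionality_dep => ij /=.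
have hi := ole_trans (oleIl (W i) (W j)) (rmapP s i).
have hj := ole_trans (oleIr (W i) (W j)) (rmapP s j).
rewrite (refine1E s (refine1 t (cochain1 z)) ij hi hj) altr_refine1.
by rewrite (refine1E (refine_comp s t) _ ij (ole_trans hi (rmapP t (s i)))
  (ole_trans hj (rmapP t (s j)))).
Qed.

Definition common_refinement (U V : open_cover X) : open_cover X.
Proof.
pose lt (p q : cidx U * cidx V) :=
  clt p.1 q.1 || `[< p.1 = q.1 >] && clt p.2 q.2.
apply: (@Cover X _ lt _ _ _ (fun p => oI (U p.1) (V p.2))).
- by move=> p; rewrite /lt !cltxx andbF.
- move=> q p r; rewrite /lt => /orP[pq|/andP[/asboolP -> pq]].
    move=> /orP[qr|/andP[/asboolP <- _]]; last by rewrite pq.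
    by rewrite (clt_trans pq qr).
  move=> /orP[-> //|/andP[/asboolP -> qr]]; apply/orP; right.
  by rewrite (clt_trans pq qr) andbT; apply/asboolP.
- move=> [i j] [i' j']; rewrite /lt /=.
  case: (clt_total i i') => [->|->|->]; [by constructor 1|by constructor 2|].
  rewrite asboolT //= !cltxx /=.
  case: (clt_total j j') => [->|->|->];
    [by constructor 1|by constructor 2|by constructor 3].
move=> x; have [i Ui] := ccover U x; have [j Vj] := ccover V x.
by exists (i, j); split.
Defined.

Definition refine_l (U V : open_cover X) : refinement (common_refinement U V) U :=
  @Refinement (common_refinement U V) U fst (fun p => oleIl (U p.1) (V p.2)).

Definition refine_r (U V : open_cover X) : refinement (common_refinement U V) V :=
  @Refinement (common_refinement U V) V snd (fun p => oleIr (U p.1) (V p.2)).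

Definition indH1 : Type := {U : open_cover X & cechH1 U}.
HB.instance Definition _ := gen_eqMixin indH1.
HB.instance Definition _ := gen_choiceMixin indH1.

Definition lim_rel (x y : indH1) : bool :=
  `[< exists (W : open_cover X) (s : refinement W (tag x)) (t : refinement W (tag y)),
        refineH1 s (tagged x) = refineH1 t (tagged y) >].

Lemma lim_rel_equiv : equiv_class_of lim_rel.
Proof.
split=> [x|x y|y x z].
- by apply/asboolP; exists (tag x), (refine_id _), (refine_id _).
- by apply/asboolP/asboolP => -[W [s [t e]]]; exists W, t, s.
- move=> /asboolP[W [s [t e]]] /asboolP[W' [s' [t' e']]]; apply/asboolP.
  exists (common_refinement W W').
  exists (refine_comp (refine_l W W') s), (refine_comp (refine_r W W') t').
  rewrite -(refineH1_comp (refine_l W W') s) e.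
  rewrite -(refineH1_comp (refine_r W W') t') -e'.
  rewrite (refineH1_comp _ _ (refine_comp (refine_l W W') t)).
  by rewrite (refineH1_comp _ _ (refine_comp (refine_l W W') t)).
Qed.

Canonical lim_rel_equivRel := EquivRelPack lim_rel_equiv.
Canonical lim_rel_encModRel := defaultEncModRel lim_rel.

Definition limH1 : Type := {eq_quot lim_rel}.
HB.instance Definition _ := Choice.on limH1.

Definition to_limH1 (U : open_cover X) (a : cechH1 U) : limH1 :=
  \pi_({eq_quot lim_rel}) (Tagged cechH1 a : indH1).

Lemma to_limH1P (U V : open_cover X) (a : cechH1 U) (b : cechH1 V) :
  to_limH1 a = to_limH1 b <->
  exists (W : open_cover X) (s : refinement W U) (t : refinement W V),
    refineH1 s a = refineH1 t b.
Proof.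
rewrite /to_limH1; split=> [/eqP|h].
  by rewrite piE => /asboolP.
by apply/eqP; rewrite piE; apply/asboolP.
Qed.

Lemma to_limH1_refine (V U : open_cover X) (t : refinement V U) (a : cechH1 U) :
  to_limH1 (refineH1 t a) = to_limH1 a.
Proof.
apply/to_limH1P; exists V, (refine_id V), t.
exact: refineH1_id.
Qed.

Lemma to_limH1_surj (x : limH1) : exists U (a : cechH1 U), x = to_limH1 a.
Proof.
exists (tag (repr x)), (tagged (repr x)); rewrite -[LHS]reprK /to_limH1.
by case: (repr x).
Qed.

Lemma to_limH1_surj2 (x y : limH1) :
  exists U (a b : cechH1 U), x = to_limH1 a /\ y = to_limH1 b.
Proof.
have [U [a ->]] := to_limH1_surj x; have [V [b ->]] := to_limH1_surj y.
exists (common_refinement U V), (refineH1 (refine_l U V) a).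
by exists (refineH1 (refine_r U V) b); rewrite !to_limH1_refine.
Qed.

Lemma to_limH1_surj3 (x y z : limH1) : exists U (a b c : cechH1 U),
  [/\ x = to_limH1 a, y = to_limH1 b & z = to_limH1 c].
Proof.
have [U [a [b [-> ->]]]] := to_limH1_surj2 x y.
have [V [c ->]] := to_limH1_surj z.
exists (common_refinement U V), (refineH1 (refine_l U V) a).
exists (refineH1 (refine_l U V) b), (refineH1 (refine_r U V) c).
by rewrite !to_limH1_refine.
Qed.

Definition trivial_cover : open_cover X.
Proof.
apply: (@Cover X unit (fun _ _ => false) _ _ _ (fun=> Opens openT)) => //.
- by case; case; constructor 3.
Defined.

Definition limH1_zero : limH1 :=
  to_limH1 (0 : cechH1 trivial_cover).

Definition limH1_opp (x : limH1) : limH1 := to_limH1 (- tagged (repr x)).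

Definition limH1_add (x y : limH1) : limH1 :=
  to_limH1 (refineH1 (refine_l (tag (repr x)) (tag (repr y))) (tagged (repr x))
          + refineH1 (refine_r (tag (repr x)) (tag (repr y))) (tagged (repr y))).

Lemma limH1_zeroE U : limH1_zero = to_limH1 (0 : cechH1 U).
Proof.
set U0 := trivial_cover.
apply/to_limH1P; exists (common_refinement U0 U), (refine_l U0 U), (refine_r U0 U).
by rewrite !raddf0.
Qed.

Lemma to_limH1_repr (x : limH1) : to_limH1 (tagged (repr x)) = x.
Proof. by rewrite /to_limH1 -[RHS]reprK; case: (repr x). Qed.

Lemma limH1_oppE U (a : cechH1 U) : limH1_opp (to_limH1 a) = to_limH1 (- a).
Proof.
have /to_limH1P[W [s [t e]]] := to_limH1_repr (to_limH1 a).
by apply/to_limH1P; exists W, s, t; rewrite !raddfN /= e.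
Qed.

Lemma limH1_addE U (a b : cechH1 U) :
  limH1_add (to_limH1 a) (to_limH1 b) = to_limH1 (a + b).
Proof.
rewrite /limH1_add; set x := to_limH1 a; set y := to_limH1 b.
have /to_limH1P[W [s [t e]]] := to_limH1_repr x.
have /to_limH1P[W' [s' [t' e']]] := to_limH1_repr y.
set P := common_refinement W W'.
set Q := common_refinement (tag (repr x)) (tag (repr y)).
set T := common_refinement P Q.
have rU : refinement T U := refine_comp (refine_l P Q) (refine_comp (refine_l W W') t).
have rQ : refinement T Q := refine_r P Q.
apply/to_limH1P; exists T, rQ, rU; rewrite !raddfD /=.
have rW : refinement T W := refine_comp (refine_l P Q) (refine_l W W').
have rW' : refinement T W' := refine_comp (refine_l P Q) (refine_r W W').
congr (_ + _).
  rewrite (refineH1_comp _ _ (refine_comp rW s)).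
  by rewrite -(refineH1_comp rW s) e (refineH1_comp _ _ rU).
rewrite (refineH1_comp _ _ (refine_comp rW' s')).
by rewrite -(refineH1_comp rW' s') e' (refineH1_comp _ _ rU).
Qed.

Lemma limH1_addA : associative limH1_add.
Proof.
move=> x y z; have [U [a [b [c [-> -> ->]]]]] := to_limH1_surj3 x y z.
by rewrite !limH1_addE addrA.
Qed.

Lemma limH1_addC : commutative limH1_add.
Proof.
move=> x y; have [U [a [b [-> ->]]]] := to_limH1_surj2 x y.
by rewrite !limH1_addE addrC.
Qed.

Lemma limH1_add0 : left_id limH1_zero limH1_add.
Proof.
move=> x; have [U [a ->]] := to_limH1_surj x.
by rewrite (limH1_zeroE U) limH1_addE add0r.
Qed.

Lemma limH1_addN : left_inverse limH1_zero limH1_opp limH1_add.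
Proof.
move=> x; have [U [a ->]] := to_limH1_surj x.
by rewrite limH1_oppE limH1_addE addNr (limH1_zeroE U).
Qed.

HB.instance Definition _ :=
  GRing.isZmodule.Build limH1 limH1_addA limH1_addC limH1_add0 limH1_addN.

Lemma to_limH1_is_zmod_morphism (U : open_cover X) : zmod_morphism (@to_limH1 U).
Proof. by move=> a b; rewrite -limH1_addE -limH1_oppE. Qed.
HB.instance Definition _ (U : open_cover X) :=
  GRing.isZmodMorphism.Build _ _ (@to_limH1 U) (@to_limH1_is_zmod_morphism U).

End Cech.

Section Locality.
Variables (K : numFieldType) (V W : normedModType K).
Implicit Types f g : V -> W.

Lemma near_eq_diff f g x :
  (\forall z \near x, f z = g z) -> differentiable f x ->
  differentiable g x /\ 'd g x = 'd f x :> (V -> W).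
Proof.
move=> fg df; have fgx : f x = g x := nbhs_singleton fg.
have E : g \o shift x = cst (g x) + 'd f x +o_ (0 : V) id.
  have /diff_locally/eqaddoP H := df.
  apply/eqaddoP => e e0; have := H e e0; move/nbhs0P : fg => fg.
  apply: filterS2 fg => h /= /esym fgh.
  by rewrite !fctE /= -fgx [h + x]addrC fgh [x + h]addrC.
have gd := diff_unique (diff_continuous df) E.
by split=> //; apply/diff_locallyP; rewrite gd; split=> //; exact: diff_continuous.
Qed.

Lemma near_eq_derive f g x v :
  (\forall z \near x, f z = g z) -> differentiable f x -> 'D_v g x = 'D_v f x.
Proof.
by move=> fg df; have [dg e] := near_eq_diff fg df; rewrite (deriveE _ dg) (deriveE _ df) e.
Qed.

End Locality.

Section Geometry.
Variable R : realType.
Local Notation C := R[i].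

(* [cinv a] inverts the chart [cmap a] on the image of its domain [cdom a];
   outside of these sets the values of both maps are irrelevant. *)
Record cmanifold (n : nat) := CManifold {
  cspace :> topologicalType;
  cmanifold_hausdorff : hausdorff_space cspace;
  cmanifold_second_countable : @second_countable cspace;
  catlas : Type;
  cdom : catlas -> set cspace;
  cmap : catlas -> cspace -> 'rV[C]_n;
  cinv : catlas -> 'rV[C]_n -> cspace;
  cdom_open : forall a, open (cdom a);
  cdom_cover : forall x, exists a, cdom a x;
  cimg_open : forall a, open (cmap a @` cdom a);
  cmapK : forall a x, cdom a x -> cinv a (cmap a x) = x;
  cmap_continuous : forall a x, cdom a x -> {for x, continuous (cmap a)};
  cinv_continuous : forall a x, cdom a x ->
    {for cmap a x, continuous (cinv a)};
  ctrans_holo : forall a b x, cdom a x -> cdom b x ->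
    differentiable (cmap b \o cinv a) (cmap a x) }.

(* In these definitions V is meant to be open. The last one is about maps on
   V * C^M. *)
Definition holo_fun n (X : cmanifold n) (W : normedModType C) (V : set X)
    (f : X -> W) : Prop :=
  forall a x, V x -> cdom a x -> differentiable (f \o cinv a) (cmap a x).

Definition holo_map n m (X : cmanifold n) (Y : cmanifold m) (V : set X)
    (f : X -> Y) : Prop :=
  forall x, V x -> {for x, continuous f} /\
    forall a b, cdom a x -> cdom b (f x) ->
      differentiable (cmap b \o f \o cinv a) (cmap a x).

Definition holo_map_prod n m M (X : cmanifold n) (Y : cmanifold m) (V : set X)
    (f : X * 'cV[C]_M -> Y) : Prop :=
  forall x v, V x -> {for (x, v), continuous f} /\
    forall a b, cdom a x -> cdom b (f (x, v)) ->
      differentiable (fun z : 'rV[C]_n * 'cV[C]_M => cmap b (f (cinv a z.1, z.2)))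
        (cmap a x, v).

(* The total space [btot] is the disjoint union of the fibers [fib x], embedded
   by [pt x]. *)
Record fiber_family n (X : cmanifold n) (M : nat) := Family {
  btot :> cmanifold (n + M);
  bproj : btot -> X;
  fib : X -> lmodType C;
  pt : forall x, fib x -> btot;
  proj_pt : forall x (v : fib x), bproj (pt v) = x;
  pt_inj : forall x, injective (@pt x);
  pt_surj : forall p, exists v : fib (bproj p), pt v = p;
  proj_holo : holo_map setT bproj }.

(* (bproj, phi) is an isomorphism of E|_V onto V * C^M, with inverse psi. *)
Definition is_trivialization n (X : cmanifold n) M (E : fiber_family X M) (V : set X)
    (phi : E -> 'cV[C]_M) : Prop :=
  [/\ forall x, V x -> linear (fun v : fib E x => phi (pt v)),
      holo_fun [set p | V (bproj p)] phi
    & exists psi : X * 'cV[C]_M -> E,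
      [/\ forall x v, V x -> bproj (psi (x, v)) = x /\ phi (psi (x, v)) = v,
          forall p, V (bproj p) -> psi (bproj p, phi p) = p
        & holo_map_prod V psi]].

Record vbundle n (X : cmanifold n) (M : nat) := VBundle {
  bfamily :> fiber_family X M;
  vbundle_triv : forall x : X, exists (V : set X) (phi : bfamily -> 'cV[C]_M),
    [/\ open V, V x & is_trivialization V phi] }.

Definition transition_system n (X : cmanifold n) M (E : vbundle X M)
    (U : open_cover X) (g : cidx U -> cidx U -> X -> 'M[C]_M) : Prop :=
  exists phi : cidx U -> E -> 'cV[C]_M,
    (forall i, is_trivialization (U i) (phi i)) /\
    forall i j,
      [/\ holo_fun (U i `&` U j) (g i j),
          forall x, (U i `&` U j) x -> g i j x \in unitmx
        & forall p, (U i `&` U j) (bproj p) ->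
            phi i p = g i j (bproj p) *m phi j p].

Section Forms.
Variables (n : nat) (X : cmanifold n).

(* A 1-form sum_k w_k dz_k is given by its coefficients in each chart a: the
   column of the w_k, as functions on [cdom a]. *)
Definition form1 : lmodType C := catlas X -> X -> 'cV[C]_n.

Definition pder (a : catlas X) (k : 'I_n) (f : X -> C) (x : X) : C :=
  'D_(delta_mx 0 k) (f \o cinv a) (cmap a x).

(* Sections over V are normalized to be 0 outside of their domain, so that two
   sections over V are the same iff they are equal as total functions. By
   [form_compat], w_a = J w_b, for J the Jacobian matrix of the change of charts
   from a to b (acting on rows). *)
Record Omega1 (V : set X) (w : form1) : Prop := IsOmega1 {
  form_supp : forall a x, ~ (V x /\ cdom a x) -> w a x = 0;
  form_compat : forall a b x, V x -> cdom a x -> cdom b x ->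
    w a x = jacobian (cmap b \o cinv a) (cmap a x) *m w b x;
  form_holo : forall a x, V x -> cdom a x ->
    differentiable (w a \o cinv a) (cmap a x) }.

(* The coefficients of dz_k /\ dz_l in dw, for k < l (extended alternatingly). *)
Definition extder (w : form1) (a : catlas X) (x : X) : 'M[C]_n :=
  \matrix_(k, l) (pder a k (fun y => w a y l 0) x
                - pder a l (fun y => w a y k 0) x).

Definition dOmega0 (V : set X) (w : form1) : Prop :=
  Omega1 V w /\ forall a x, V x -> cdom a x -> extder w a x = 0.

Definition in_dOmega0 (V : opens X) : {pred form1} := fun w => `[< dOmega0 V w >].

Lemma coord_chart_differentiable (w : form1) a x k :
  differentiable (w a \o cinv a) (cmap a x) ->
  differentiable ((fun y => w a y k 0) \o cinv a) (cmap a x).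
Proof.
move=> dw.
exact: (differentiable_comp (g := fun M : 'cV[C]_n => M k 0) dw
  (differentiable_coord _ _ _)).
Qed.

Lemma pderB a k (f h : X -> C) x :
  differentiable (f \o cinv a) (cmap a x) ->
  differentiable (h \o cinv a) (cmap a x) ->
  pder a k (fun y => f y - h y) x = pder a k f x - pder a k h x.
Proof.
move=> df dh; rewrite /pder -deriveB; [by []|exact: diff_derivable..].
Qed.

Lemma in_dOmega0_zmod_closed V : zmod_closed (in_dOmega0 V).
Proof.
split=> [|w u]; rewrite !unfold_in.
  apply/asboolP; split.
    split=> [//|a b x _ _ _|a x _ _]; first by rewrite mulmx0.
    exact: (differentiable_cst (0 : 'cV[C]_n)).
  move=> a x _ _; apply/matrixP => k l; rewrite !mxE /pder.
  have Z (j : 'I_n) : (fun y : X => (0 : form1) a y j 0) \o cinv a = cst 0.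
    by apply/funext => y; rewrite /= mxE.
  by rewrite !Z !derive_cst subrr mxE.
move=> /asboolP[[ws wc wh] wd] /asboolP[[us uc uh] ud]; apply/asboolP.
split.
  split=> [a x h|a b x Vx ax bx|a x Vx ax].
  - by rewrite !fctE ws // us // subrr.
  - by rewrite !fctE mulmxBr -wc // -uc.
  - exact: (differentiableB (wh a x Vx ax) (uh a x Vx ax)).
move=> a x Vx ax.
have E k l : pder a k (fun y => (w - u) a y l 0) x =
    pder a k (fun y => w a y l 0) x - pder a k (fun y => u a y l 0) x.
  rewrite -pderB; last 2 first.
  - exact/coord_chart_differentiable/wh.
  - exact/coord_chart_differentiable/uh.
  congr (pder a k _ x); apply/funext => y.
  by rewrite (_ : (w - u) a y = w a y - u a y) // mxE [X in _ + X]mxE.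
apply/matrixP => k l; rewrite mxE (E k l) (E l k).
have /matrixP/(_ k l) := wd a x Vx ax; rewrite !mxE => /subr0_eq ->.
have /matrixP/(_ k l) := ud a x Vx ax; rewrite !mxE => /subr0_eq ->.
exact: subrr.
Qed.
HB.instance Definition _ V :=
  GRing.isZmodClosed.Build _ (in_dOmega0 V) (in_dOmega0_zmod_closed V).

Record closed_form (V : opens X) := ClosedForm {
  form_of :> form1;
  _ : form_of \in in_dOmega0 V }.
HB.instance Definition _ V := [isSub for @form_of V].
HB.instance Definition _ V := [Choice of closed_form V by <:].
HB.instance Definition _ V := [SubChoice_isSubZmodule of closed_form V by <:].

Definition cutoff (V : set X) (w : form1) : form1 :=
  fun a x => if `[< V x >] then w a x else 0.

Lemma cutoff_dOmega0 (V W : opens X) (w : form1) :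
  ole V W -> dOmega0 W w -> dOmega0 V (cutoff V w).
Proof.
move=> VW [[ws wc wh] wd].
have near_eq a x : oset V x -> cdom a x ->
    \forall z \near cmap a x, w a (cinv a z) = cutoff V w a (cinv a z).
  move=> Vx ax; have Vn : nbhs (cinv a (cmap a x)) V.
    by rewrite cmapK //; apply: open_nbhs_nbhs; split => //; exact: oset_open.
  have : nbhs (cmap a x) (cinv a @^-1` V) by exact: (cinv_continuous ax) Vn.
  apply: filterS => z /= Vz.
  by rewrite /cutoff asboolT.
split.
  split=> [a x h|a b x Vx ax bx|a x Vx ax].
  - rewrite /cutoff; case: asboolP => // Vx; rewrite ws // => -[_ ax].
    by apply: h.
  - by rewrite /cutoff asboolT // (wc a b) //; exact: VW.
  - by have [] := near_eq_diff (near_eq a x Vx ax) (wh a x (VW _ Vx) ax).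
move=> a x Vx ax.
have E i j : pder a i (fun y => cutoff V w a y j 0) x =
             pder a i (fun y => w a y j 0) x.
  apply: near_eq_derive.
    by apply: filterS (near_eq a x Vx ax) => z /= ->.
  by apply: coord_chart_differentiable; apply: wh => //; exact: VW.
rewrite -(wd a x (VW _ Vx) ax); apply/matrixP => k l.
by rewrite [LHS]mxE [RHS]mxE (E k l) (E l k).
Qed.

Lemma closed_formP V (w : closed_form V) : dOmega0 V w.
Proof. by case: w => w /= /asboolP. Qed.

Section Restriction.
Variables (V W : opens X) (VW : ole V W).

Lemma cutoff_in (w : closed_form W) : cutoff V w \in in_dOmega0 V.
Proof. apply/asboolP; exact: cutoff_dOmega0 VW (closed_formP w). Qed.

Definition restrict_form (w : closed_form W) : closed_form V :=
  ClosedForm (cutoff_in w).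

Lemma restrict_form_is_zmod_morphism : zmod_morphism restrict_form.
Proof.
move=> w u; apply: val_inj; apply/funext => a; apply/funext => x /=.
by rewrite /cutoff !fctE; case: asboolP => // _; rewrite ?fctE ?subrr.
Qed.
HB.instance Definition _ :=
  GRing.isZmodMorphism.Build _ _ restrict_form restrict_form_is_zmod_morphism.
End Restriction.

Definition dOmega0_sheaf : presheaf X.
Proof.
apply: (@Presheaf X (fun V => closed_form V) (fun V W VW => restrict_form VW)).
- move=> V h w; apply: val_inj; apply/funext => a; apply/funext => x /=.
  have [[ws _ _] _] := closed_formP w.
  by rewrite /cutoff; case: asboolP => // nVx; rewrite ws // => -[].
- move=> U V W UV VW UW w; apply: val_inj; apply/funext => a; apply/funext => x /=.
  rewrite /cutoff; case: asboolP => // Ux.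
  by rewrite asboolT //; exact: UV.
Defined.

(* tr(h^-1 dh), where dh is the entrywise differential; see [Omega1] for the
   normalization. *)
Definition tr_dlog M (V : set X) (h : X -> 'M[C]_M) : form1 := fun a x =>
  if `[< V x /\ cdom a x >]
  then \col_k \tr (invmx (h x) *m \matrix_(p, q) pder a k (fun y => h y p q) x)
  else 0.

End Forms.

Section FirstT.
Variables (n : nat) (X : cmanifold n) (M : nat) (U : open_cover X).
Variable g : cidx U -> cidx U -> X -> 'M[C]_M.

Definition t_form (i1 i2 : cidx U) : form1 X :=
  let i := tnth [tuple i1; i2] in
  \sum_(s : 'S_2) ((-1) ^+ s / (2`!)%:R) *:
    tr_dlog (U i1 `&` U i2) (g (i (s ord0)) (i (s ord_max))).

(* The [insubd 0] only make these total functions: for a system of transition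
   functions, t_form is in dOmega0 and f1r_cochain is a cocycle. *)
Definition f1r_cochain : cech1 (dOmega0_sheaf X) U :=
  fun i1 i2 _ => insubd (0 : closed_form (oI (U i1) (U i2))) (t_form i1 i2).

Definition f1r_cover : cechH1 (dOmega0_sheaf X) U :=
  cech_class (insubd (0 : cocycle1 _ U) f1r_cochain).

Definition f1r : limH1 (dOmega0_sheaf X) := to_limH1 f1r_cover.

End FirstT.
End Geometry.

(* Main.v *)
Require Import Defs.
From HB Require Import structures.
From mathcomp Require Import all_boot all_order all_algebra all_fingroup.
From mathcomp Require Import all_classical all_reals all_analysis.
From mathcomp Require Import complex ring lra.

Set Implicit Arguments.
Unset Strict Implicit.
Unset Printing Implicit Defensive.

Import numFieldNormedType.Exports.
Import Order.TTheory GRing.Theory Num.Theory.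

Local Open Scope classical_set_scope.
Local Open Scope ring_scope.
Local Open Scope complex_scope.

(** The forms tr(g_ij^-1 dg_ij) are logarithmic differentials of scalar
    functions: by Jacobi's formula [jacobi_formula], tr(h^-1 dh) = du/u with
    u = det h ([tr_dlog_det]). The determinants u_ij of the transition functions
    inherit the cocycle identity u_ik = u_ij u_jk from the matrices, and
    u |-> du/u turns products into sums ([dlogM]), so the t_ij form a cocycle.

    Two systems of transition functions of E on the same cover come from two
    families of trivializations. They differ by matrix functions l_i with
    g'_ij l_j = l_i g_ij, holomorphic because l_i is a trivialization composed
    with the inverse of another one ([change_of_systems]). Taking du/u of
    determinants, the cocycles differ by the coboundary of the 0-cochain
    - d(det l_i)/det l_i ([f1r_cover_indep]). Two different covers are compared
    on their common refinement: pulling a system of transition functions back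
    along a refinement pulls the cocycle back ([refineH1_f1r_cover]), and on the
    common refinement both classes belong to systems of the same bundle.

    The analytic content is that du/u is a closed holomorphic form
    ([dlog_closed]), where holomorphic means once complex differentiable at
    each point. Hence partial derivatives of a holomorphic function of several
    variables must again be holomorphic ([differentiable_derive]) and must
    commute ([derive_sym]). In one variable, Goursat's bisection argument
    ([goursat_rectangle]) yields Cauchy's formula on a square
    ([cauchy_formula]), and expanding its kernel gives a Taylor expansion of
    order two whose error is bounded by a universal multiple of sup |f|
    ([cauchy_taylor2]). Since the bound is uniform, it applies to the
    restrictions t |-> f(q + t v) to all complex lines near a given point at
    once. Comparing the expansions of f at p and at p + t u gives
      D_v f (p + t u) = D_v f (p) + t H(u, v) + O(t^2)
    with H symmetric ([hess_expansion], [hessC]); H is linear in one argument as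
    a limit of the linear maps v |-> D_v f, hence in both ([hess_row]). This is
    the differentiability of D_v f together with the symmetry of second
    derivatives. *)

Local Notation reC := complex.Re.
Local Notation imC := complex.Im.


(** * Complex numbers as a normed field over the reals *)
Section ComplexTopology.
Variable R : realType.
Local Notation C := R[i].
Implicit Types (z w : C).

Lemma normC_real z : `|z| = (reC `|z|)%:C.
Proof. by rewrite RRe_real ?ger0_real. Qed.

Lemma ler_Re_normC z : `|reC z| <= reC `|z|.
Proof. by rewrite -lecR -normC_real normc_ge_Re. Qed.

Lemma normC_i : `|'i| = 1 :> C.
Proof. by rewrite normc_def /= expr0n expr1n add0r sqrtr1. Qed.

Lemma ler_Im_normC z : `|imC z| <= reC `|z|.
Proof.
have := ler_Re_normC (z * 'i); rewrite ReiNIm normrN.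
by rewrite normrM normC_i mulr1.
Qed.

Lemma normC_le_ReIm z : `|z| <= (`|reC z| + `|imC z|)%:C.
Proof.
rewrite [z in leLHS]complexE (le_trans (ler_normD _ _))// normrM.
rewrite normC_i mul1r.
by rewrite rmorphD /= !normc_def /= !expr0n /= !addr0 !sqrtr_sqr.
Qed.

Lemma posC_ex (e : C) : 0 < e -> exists2 d : R, 0 < d & e = d%:C.
Proof.
move=> e0; exists (reC e); last by rewrite RRe_real // gtr0_real.
by rewrite -ltcR RRe_real // gtr0_real.
Qed.

Lemma near_normC (V : normedModType C) (p : V) (P : set V) :
  (\forall q \near p, P q) <->
  exists2 d : R, 0 < d & forall q, `|q - p| < d%:C -> P q.
Proof.
split=> [/nbhs_ballP[e /posC_ex[d d0 ->]] pP|[d d0 pP]].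
  exists d => // q qp; apply: pP.
  by rewrite -ball_normE /ball_ /= distrC.
apply/nbhs_ballP; exists d%:C; first by rewrite /= ltcR.
by move=> q; rewrite -ball_normE /ball_ /= distrC => /pP.
Qed.

Lemma continuous_Re : continuous (@complex.Re R : C -> R).
Proof.
move=> z; have FF : Filter (nbhs z) by exact: nbhs_filter.
apply/cvgrPdist_lt => e e0; apply/(@near_normC C z); exists e => // w zw.
rewrite -raddfB (le_lt_trans (ler_Re_normC _)) //.
by rewrite -ltcR -normC_real distrC.
Qed.

Lemma continuous_Im : continuous (@complex.Im R : C -> R).
Proof.
move=> z; have FF : Filter (nbhs z) by exact: nbhs_filter.
apply/cvgrPdist_lt => e e0; apply/(@near_normC C z); exists e => // w zw.
rewrite -raddfB (le_lt_trans (ler_Im_normC _)) //.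
by rewrite -ltcR -normC_real distrC.
Qed.

Lemma continuous_complex (T : topologicalType) (f g : T -> R) x :
  {for x, continuous f} -> {for x, continuous g} ->
  {for x, continuous (fun y => f y +i* g y : C)}.
Proof.
move=> fx gx; apply/cvgrPdist_lt => e /posC_ex[d d0 ->].
have d2 : 0 < d / 2 by rewrite divr_gt0.
move/cvgrPdist_lt : fx => /(_ _ d2) fx; move/cvgrPdist_lt : gx => /(_ _ d2) gx.
apply: filterS2 fx gx => y fy gy.
rewrite (le_lt_trans (normC_le_ReIm _)) // ltcR /=.
by rewrite [d]splitr ltrD.
Qed.

Lemma continuousC_D (T : topologicalType) (f g : T -> C) x :
  {for x, continuous f} -> {for x, continuous g} ->
  {for x, continuous (fun y => f y + g y)}.
Proof. exact: (@continuousD C C T f g x). Qed.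

Lemma continuousC_M (T : topologicalType) (f g : T -> C) x :
  {for x, continuous f} -> {for x, continuous g} ->
  {for x, continuous (fun y => f y * g y)}.
Proof. exact: (@continuousM C T f g x). Qed.

End ComplexTopology.

(** * Integrals of complex-valued functions of a real variable *)
Section ComplexIntegral.
Variable R : realType.
Local Notation C := R[i].
Local Notation mu := (@lebesgue_measure R).
Implicit Types (g h : R -> C) (a b : R).

Definition cint a b g : C :=
  (\int[mu]_(t in `[a, b]) reC (g t)) +i* (\int[mu]_(t in `[a, b]) imC (g t)).

(** Continuity is asked of [g] as a function on the whole line, so that the
    hypothesis passes to subintervals and to combinations pointwise. *)
Definition contseg a b g := forall t, a <= t <= b -> {for t, continuous g}.

Lemma integrable_continuous_at a b (f : R -> R) :
  (forall t, a <= t <= b -> {for t, continuous f}) ->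
  mu.-integrable `[a, b] (EFin \o f).
Proof.
move=> cf; apply: continuous_compact_integrable; first exact: segment_compact.
apply: continuous_in_subspaceT => t; rewrite inE /= in_itv /=; exact: cf.
Qed.

Lemma contseg_Re a b g : contseg a b g -> mu.-integrable `[a, b] (EFin \o (@complex.Re R \o g)).
Proof.
move=> cg; apply: integrable_continuous_at => t /cg gt.
apply: continuous_comp gt _; exact: continuous_Re.
Qed.

Lemma contseg_Im a b g : contseg a b g -> mu.-integrable `[a, b] (EFin \o (@complex.Im R \o g)).
Proof.
move=> cg; apply: integrable_continuous_at => t /cg gt.
apply: continuous_comp gt _; exact: continuous_Im.
Qed.

Lemma eq_cint a b g h : (forall t, a <= t <= b -> g t = h t) -> cint a b g = cint a b h.
Proof.
by move=> gh; congr (_ +i* _); apply: eq_Rintegral => t;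
  rewrite inE /= in_itv /= => /gh ->.
Qed.

Lemma cintD a b g h : contseg a b g -> contseg a b h ->
  cint a b (fun t => g t + h t) = cint a b g + cint a b h.
Proof.
move=> cg ch; rewrite /cint; simpc; congr (_ +i* _).
  rewrite -RintegralD //; [|exact: contseg_Re..].
  by apply: eq_Rintegral => t _; rewrite raddfD.
rewrite -RintegralD //; [|exact: contseg_Im..].
by apply: eq_Rintegral => t _; rewrite raddfD.
Qed.

Lemma cintZ a b k g : contseg a b g ->
  cint a b (fun t => k * g t) = k * cint a b g.
Proof.
move=> cg; case: k => p q; rewrite /cint; simpc; congr (_ +i* _).
  rewrite -!RintegralZl //; [|exact: contseg_Im|exact: contseg_Re].
  rewrite -RintegralB //=; first by apply: eq_Rintegral => t _; case: (g t).
    rewrite (_ : _ \o _ = cst p%:E \* (EFin \o (@complex.Re R \o g)))%E //.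
    by apply: integrableZl => //; exact: contseg_Re.
  rewrite (_ : _ \o _ = cst q%:E \* (EFin \o (@complex.Im R \o g)))%E //.
  by apply: integrableZl => //; exact: contseg_Im.
rewrite -!RintegralZl //; [|exact: contseg_Re|exact: contseg_Im].
rewrite -RintegralD //=; first by apply: eq_Rintegral => t _; case: (g t).
  rewrite (_ : _ \o _ = cst p%:E \* (EFin \o (@complex.Im R \o g)))%E //.
  by apply: integrableZl => //; exact: contseg_Im.
rewrite (_ : _ \o _ = cst q%:E \* (EFin \o (@complex.Re R \o g)))%E //.
by apply: integrableZl => //; exact: contseg_Re.
Qed.

Lemma cintB a b g h : contseg a b g -> contseg a b h ->
  cint a b (fun t => g t - h t) = cint a b g - cint a b h.
Proof.
move=> cg ch; have cN : contseg a b (fun t => - 1 * h t).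
  by move=> t tI; apply: continuousC_M; [exact: cst_continuous|exact: ch].
transitivity (cint a b (fun t => g t + - 1 * h t)).
  by apply: eq_cint => t _; rewrite mulN1r.
by rewrite (cintD cg cN) cintZ // mulN1r.
Qed.

Lemma Rint_seg_cst a b k : a <= b -> \int[mu]_(t in `[a, b]) (cst k t) = k * (b - a).
Proof.
move=> ab; rewrite Rintegral_cst //= lebesgue_measure_itv /= lte_fin.
by case: ltgtP ab => // -> _; rewrite subrr.
Qed.

Lemma cint_cst a b k : a <= b -> cint a b (fun=> k) = k * (b - a)%:C.
Proof.
move=> ab; rewrite /cint (Rint_seg_cst (reC k)) // (Rint_seg_cst (imC k)) //.
by case: k => p q; simpc.
Qed.

Lemma RintM a b (f : R -> R) (M : R) : a <= b ->
  (forall t, a <= t <= b -> {for t, continuous f}) ->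
  (forall t, a <= t <= b -> `|f t| <= M) ->
  `|\int[mu]_(t in `[a, b]) f t| <= M * (b - a).
Proof.
move=> ab cf fM; have If := integrable_continuous_at cf.
have I1 (k : R) : mu.-integrable `[a, b] (EFin \o cst k).
  by apply: integrable_continuous_at => t _; exact: cst_continuous.
rewrite ler_norml -mulNr -!(Rint_seg_cst _ ab).
apply/andP; split; apply: le_Rintegral => // t; rewrite /= in_itv /= => /fM;
  by rewrite ler_norml => /andP[].
Qed.

(** Real and imaginary parts are bounded separately, whence the factor 2. *)
Lemma cint_bound a b g (M : R) : a <= b -> contseg a b g ->
  (forall t, a <= t <= b -> `|g t| <= M%:C) ->
  `|cint a b g| <= (2 * M * (b - a))%:C.
Proof.
move=> ab cg gM; rewrite (le_trans (normC_le_ReIm _)) // lecR /=.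
rewrite -mulrA mulr_natl mulr2n lerD // RintM // => t tab.
- by apply: continuous_comp (cg _ tab) _; exact: continuous_Re.
- by rewrite (le_trans (ler_Re_normC _)) // -lecR -normC_real gM.
- by apply: continuous_comp (cg _ tab) _; exact: continuous_Im.
- by rewrite (le_trans (ler_Im_normC _)) // -lecR -normC_real gM.
Qed.

Lemma Rint_cat a b c (f : R -> R) : a <= b -> b <= c -> mu.-integrable `[a, c] (EFin \o f) ->
  \int[mu]_(t in `[a, c]) f t = \int[mu]_(t in `[a, b]) f t + \int[mu]_(t in `[b, c]) f t.
Proof.
move=> ab bc If; have := @Rintegral_itvB R f (BLeft a) (BRight c) b If.
rewrite !bnd_simp => /(_ ab bc) /eqP; rewrite subr_eq addrC => /eqP ->.
congr (_ + _); apply: Rintegral_itv_obnd_cbnd.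
by apply: integrableS If => //; apply: subset_itvr; rewrite bnd_simp.
Qed.

Lemma cint_cat a b c g : a <= b -> b <= c -> contseg a c g ->
  cint a c g = cint a b g + cint b c g.
Proof.
move=> ab bc cg; rewrite /cint; simpc; congr (_ +i* _); apply: Rint_cat => //.
  exact: contseg_Re.
exact: contseg_Im.
Qed.

End ComplexIntegral.

(** * Integrals along the boundary of a rectangle *)
Section Rectangles.
Variable R : realType.
Local Notation C := R[i].
Implicit Types (f g : C -> C) (z w k : C) (x y : R).

Definition inrect (x0 x1 y0 y1 : R) z :=
  [&& x0 <= reC z, reC z <= x1, y0 <= imC z & imC z <= y1].

(** The boundary of the rectangle. *)
Definition onframe (x0 x1 y0 y1 : R) z :=
  inrect x0 x1 y0 y1 z &&
  [|| reC z == x0, reC z == x1, imC z == y0 | imC z == y1].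

Definition contframe x0 x1 y0 y1 f :=
  forall z, onframe x0 x1 y0 y1 z -> {for z, continuous f}.

(** The contour integral of [f], counterclockwise. *)
Definition bint f (x0 x1 y0 y1 : R) : C :=
  cint x0 x1 (fun t => f (t +i* y0)) - cint x0 x1 (fun t => f (t +i* y1)) +
  'i * (cint y0 y1 (fun t => f (x1 +i* t)) - cint y0 y1 (fun t => f (x0 +i* t))).

Lemma contseg_hor f y a b :
  (forall t, a <= t <= b -> {for t +i* y, continuous f}) ->
  contseg a b (fun t => f (t +i* y)).
Proof.
move=> cf t /cf ft; apply: (@continuous_comp R C C (fun t => t +i* y) f t _ ft).
by apply: continuous_complex; [exact: cvg_id|exact: cst_continuous].
Qed.

Lemma contseg_ver f x a b :
  (forall t, a <= t <= b -> {for x +i* t, continuous f}) ->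
  contseg a b (fun t => f (x +i* t)).
Proof.
move=> cf t /cf ft; apply: (@continuous_comp R C C (fun t => x +i* t) f t _ ft).
by apply: continuous_complex; [exact: cst_continuous|exact: cvg_id].
Qed.

Section Frame.
Variables (x0 x1 y0 y1 : R).
Hypotheses (x01 : x0 <= x1) (y01 : y0 <= y1).

Lemma onframe_b t : x0 <= t <= x1 -> onframe x0 x1 y0 y1 (t +i* y0).
Proof. by move=> /andP[? ?]; apply/andP; rewrite /inrect /= !eqxx !orbT; split=> //; apply/and4P. Qed.
Lemma onframe_t t : x0 <= t <= x1 -> onframe x0 x1 y0 y1 (t +i* y1).
Proof. by move=> /andP[? ?]; apply/andP; rewrite /inrect /= !eqxx !orbT; split=> //; apply/and4P. Qed.
Lemma onframe_l t : y0 <= t <= y1 -> onframe x0 x1 y0 y1 (x0 +i* t).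
Proof. by move=> /andP[? ?]; apply/andP; rewrite /inrect /= !eqxx; split=> //; apply/and4P. Qed.
Lemma onframe_r t : y0 <= t <= y1 -> onframe x0 x1 y0 y1 (x1 +i* t).
Proof. by move=> /andP[? ?]; apply/andP; rewrite /inrect /= !eqxx !orbT; split=> //; apply/and4P. Qed.

Lemma contframe_b f : contframe x0 x1 y0 y1 f -> contseg x0 x1 (fun t => f (t +i* y0)).
Proof. by move=> cf; apply: contseg_hor => t /onframe_b/cf. Qed.
Lemma contframe_t f : contframe x0 x1 y0 y1 f -> contseg x0 x1 (fun t => f (t +i* y1)).
Proof. by move=> cf; apply: contseg_hor => t /onframe_t/cf. Qed.
Lemma contframe_l f : contframe x0 x1 y0 y1 f -> contseg y0 y1 (fun t => f (x0 +i* t)).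
Proof. by move=> cf; apply: contseg_ver => t /onframe_l/cf. Qed.
Lemma contframe_r f : contframe x0 x1 y0 y1 f -> contseg y0 y1 (fun t => f (x1 +i* t)).
Proof. by move=> cf; apply: contseg_ver => t /onframe_r/cf. Qed.
Hint Resolve contframe_b contframe_t contframe_l contframe_r : core.

Lemma eq_bint f g : (forall z, onframe x0 x1 y0 y1 z -> f z = g z) ->
  bint f x0 x1 y0 y1 = bint g x0 x1 y0 y1.
Proof.
move=> fg; congr (_ - _ + 'i * (_ - _)); apply: eq_cint => t tI; apply: fg.
- exact: onframe_b.
- exact: onframe_t.
- exact: onframe_r.
- exact: onframe_l.
Qed.

Lemma bintD f g : contframe x0 x1 y0 y1 f -> contframe x0 x1 y0 y1 g ->
  bint (fun z => f z + g z) x0 x1 y0 y1 = bint f x0 x1 y0 y1 + bint g x0 x1 y0 y1.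
Proof. by move=> cf cg; rewrite /bint !cintD; auto; ring. Qed.

Lemma bintZ f k : contframe x0 x1 y0 y1 f ->
  bint (fun z => k * f z) x0 x1 y0 y1 = k * bint f x0 x1 y0 y1.
Proof. by move=> cf; rewrite /bint !cintZ; auto; ring. Qed.

Lemma bint_bound f (M : R) : contframe x0 x1 y0 y1 f ->
  (forall z, onframe x0 x1 y0 y1 z -> `|f z| <= M%:C) ->
  `|bint f x0 x1 y0 y1| <= (4 * M * ((x1 - x0) + (y1 - y0)))%:C.
Proof.
move=> cf fM; rewrite (le_trans (ler_normD _ _)) // normrM.
rewrite normC_i mul1r.
rewrite (le_trans (lerD (ler_normB _ _) (ler_normB _ _))) //.
have -> : 4 * M * ((x1 - x0) + (y1 - y0)) =
  (2 * M * (x1 - x0) + 2 * M * (x1 - x0)) + (2 * M * (y1 - y0) + 2 * M * (y1 - y0)) by ring.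
rewrite (rmorphD _ (_ + _)) !(rmorphD (real_complex R) (2 * _ * _)) /=.
apply: lerD; apply: lerD; apply: cint_bound; auto => t tI; apply: fM.
- exact: onframe_b.
- exact: onframe_t.
- exact: onframe_r.
- exact: onframe_l.
Qed.

(** The two integrals along the cut cancel. *)
Lemma bint_cutx f x : contframe x0 x1 y0 y1 f -> x0 <= x -> x <= x1 ->
  bint f x0 x1 y0 y1 = bint f x0 x y0 y1 + bint f x x1 y0 y1.
Proof.
by move=> cf xl xr; rewrite /bint !(@cint_cat _ x0 x x1); auto; ring.
Qed.

Lemma bint_cuty f y : contframe x0 x1 y0 y1 f -> y0 <= y -> y <= y1 ->
  bint f x0 x1 y0 y1 = bint f x0 x1 y0 y + bint f x0 x1 y y1.
Proof.
by move=> cf yl yr; rewrite /bint !(@cint_cat _ y0 y y1); auto; ring.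
Qed.

(** Pairing opposite sides lets cancellation between them be seen pointwise. *)
Lemma bint_pair f : contframe x0 x1 y0 y1 f ->
  bint f x0 x1 y0 y1 =
    cint x0 x1 (fun t => f (t +i* y0) - f (t +i* y1)) +
    'i * cint y0 y1 (fun t => f (x1 +i* t) - f (x0 +i* t)).
Proof. by move=> cf; rewrite !cintB; auto. Qed.

(** The difference of an affine function between opposite sides is constant;
    the contributions of the two pairs of sides are opposite. *)
Lemma bint_affine k k' : bint (fun z => k + k' * z) x0 x1 y0 y1 = 0.
Proof.
rewrite bint_pair; last first.
  move=> z _; apply: continuousC_D; first exact: cst_continuous.
  by apply: continuousC_M; [exact: cst_continuous|exact: cvg_id].
rewrite (@eq_cint _ _ _ _ (fun=> k' * (0 +i* (y0 - y1)))); last first.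
  move=> t _; rewrite (_ : 0 +i* (y0 - y1) = (t +i* y0) - (t +i* y1)); first by ring.
  by simpc.
rewrite [X in _ + _ * X](@eq_cint _ _ _ _ (fun=> k' * ((x1 - x0) +i* 0))); last first.
  move=> t _; rewrite (_ : (x1 - x0) +i* 0 = (x1 +i* t) - (x0 +i* t)); first by ring.
  by simpc.
rewrite !cint_cst //; case: k' => p q; simpc; congr (_ +i* _); ring.
Qed.

End Frame.

End Rectangles.

(** * Goursat's theorem *)
Section Goursat.
Variable R : realType.
Local Notation C := R[i].
Implicit Types (f g : C -> C) (z p : C) (x y : R).

(** Complex differentiability in the form used by the bisection argument, with
    real [e] and [r]. *)
Lemma differentiable_estimate f p : differentiable f p ->
  exists d : C, forall e : R, 0 < e -> exists2 r : R, 0 < r &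
    forall w, `|w - p| < r%:C -> `|f w - (f p + d * (w - p))| <= e%:C * `|w - p|.
Proof.
move=> df; exists ('d f p 1) => e e0.
have /diff_locally/eqaddoP H := df.
have /H /near_normC[r r0 rP] : 0 < e%:C by rewrite ltcR.
exists r => // w wp; have := rP (w - p); rewrite subr0 => /(_ wp).
rewrite !fctE /= subrK.
by rewrite (_ : 'd f p (w - p) = 'd f p 1 * (w - p)) // mulrC -linearZ /= [_ *: _]mulr1.
Qed.

Lemma differentiableC_continuous f p : differentiable f p -> {for p, continuous f}.
Proof. exact: differentiable_continuous. Qed.

Lemma normC_rect (x y w h : R) (z p : C) :
  inrect x (x + w) y (y + h) z -> inrect x (x + w) y (y + h) p ->
  `|z - p| <= (w + h)%:C.
Proof.
move=> /and4P[? ? ? ?] /and4P[? ? ? ?].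
rewrite (le_trans (normC_le_ReIm _)) // lecR !raddfB /=.
by apply: lerD; rewrite ler_norml; apply/andP; split; lra.
Qed.

(** Goursat's argument: if the integral I over the boundary were nonzero, one
    quarter of the rectangle would carry at least |I|/4, a quarter of that one at
    least |I|/16, and so on. The rectangles shrink to a point [p]; near [p], [f]
    is affine up to an error that is small compared to the distance to [p], and
    the affine part integrates to 0, which contradicts the lower bounds. *)
Section Bisection.
Variables (f : C -> C) (x0 y0 w h : R).
Hypotheses (w0 : 0 <= w) (h0 : 0 <= h).
Hypothesis df : forall z, inrect x0 (x0 + w) y0 (y0 + h) z -> differentiable f z.

Let subrect (s : R * R) k :=
  [/\ x0 <= s.1, s.1 + w / 2 ^+ k <= x0 + w, y0 <= s.2 & s.2 + h / 2 ^+ k <= y0 + h].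
Let B (s : R * R) k := bint f s.1 (s.1 + w / 2 ^+ k) s.2 (s.2 + h / 2 ^+ k).

Let pow2 k : 0 < 2 ^+ k :> R. Proof. exact: exprn_gt0. Qed.
Let wk k : 0 <= w / 2 ^+ k. Proof. by rewrite divr_ge0 // ltW. Qed.
Let hk k : 0 <= h / 2 ^+ k. Proof. by rewrite divr_ge0 // ltW. Qed.
Let halfw k : w / 2 ^+ k = w / 2 ^+ k.+1 + w / 2 ^+ k.+1.
Proof. by rewrite exprSr invfM mulrA -splitr. Qed.
Let halfh k : h / 2 ^+ k = h / 2 ^+ k.+1 + h / 2 ^+ k.+1.
Proof. by rewrite exprSr invfM mulrA -splitr. Qed.

Let cont_sub (a b c d : R) : x0 <= a -> b <= x0 + w -> y0 <= c -> d <= y0 + h ->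
  contframe a b c d f.
Proof.
move=> ? ? ? ? z /andP[/and4P[? ? ? ?] _]; apply: differentiableC_continuous.
by apply: df; apply/and4P; split; lra.
Qed.

Let step s k : subrect s k -> exists s', [/\ subrect s' k.+1, s.1 <= s'.1,
  s'.1 + w / 2 ^+ k.+1 <= s.1 + w / 2 ^+ k,
  s.2 <= s'.2 /\ s'.2 + h / 2 ^+ k.+1 <= s.2 + h / 2 ^+ k
  & `|B s k| <= 4 * `|B s' k.+1| ].
Proof.
case: s => x y [/= xl xr yl yr].
set a := w / 2 ^+ k.+1; set b := h / 2 ^+ k.+1.
have a0 : 0 <= a by exact: wk. have b0 : 0 <= b by exact: hk.
have ea : w / 2 ^+ k = a + a by exact: halfw.
have eb : h / 2 ^+ k = b + b by exact: halfh.
rewrite ea in xr; rewrite eb in yr.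
have E : B (x, y) k = B (x, y) k.+1 + B (x, y + b) k.+1 +
                      (B (x + a, y) k.+1 + B (x + a, y + b) k.+1).
  rewrite /B /= -/a -/b ea eb.
  transitivity (bint f x (x + a) y (y + (b + b)) + bint f (x + a) (x + (a + a)) y (y + (b + b))).
    by apply: bint_cutx; try (apply: cont_sub); lra.
  rewrite -[x + a + a]addrA -[y + b + b]addrA; congr (_ + _).
    by apply: bint_cuty; try (apply: cont_sub); lra.
  by apply: bint_cuty; try (apply: cont_sub); lra.
(* Were all four integrals less than a quarter of the whole in norm, their sum
   would be too small. *)
have [H|H] := pselect (exists s', s' \in [:: (x, y); (x, y + b); (x + a, y); (x + a, y + b)] /\
    `|B (x, y) k| <= 4 * `|B s' k.+1|).
  case: H => s' [s'I H]; exists s'; rewrite /subrect -/a -/b ea eb.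
  have F1 : x + a <= x + (a + a) by lra.
  have F2 : x + a + a <= x + (a + a) by lra.
  have F3 : y + b <= y + (b + b) by lra.
  have F4 : y + b + b <= y + (b + b) by lra.
  have F5 : x <= x + a by lra.
  have F6 : y <= y + b by lra.
  have G1 : x0 <= x + a by lra.
  have G2 : y0 <= y + b by lra.
  have G3 : x + a <= x0 + w by lra.
  have G4 : x + a + a <= x0 + w by lra.
  have G5 : y + b <= y0 + h by lra.
  have G6 : y + b + b <= y0 + h by lra.
  by move: s'I H; rewrite !inE => /or4P[] /eqP -> /= H.
exfalso; apply: H; apply: contrapT => H.
have L s' : s' \in [:: (x, y); (x, y + b); (x + a, y); (x + a, y + b)] ->
    4 * `|B s' k.+1| < `|B (x, y) k|.
  move=> s'I; rewrite real_ltNge ?ger0_real ?mulr_ge0 //; apply/negP => le; apply: H.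
  by exists s'.
have T : 4 * `|B (x, y) k.+1 + B (x, y + b) k.+1 +
                      (B (x + a, y) k.+1 + B (x + a, y + b) k.+1)| < 4 * `|B (x, y) k|.
  apply: (@le_lt_trans _ _ (4 * `|B (x, y) k.+1| + 4 * `|B (x, y + b) k.+1| +
                      (4 * `|B (x + a, y) k.+1| + 4 * `|B (x + a, y + b) k.+1|))).
    rewrite -!mulrDr ler_pM2l // (le_trans (ler_normD _ _)) // lerD // ler_normD //.
  have -> : 4 * `|B (x, y) k| = `|B (x, y) k| + `|B (x, y) k| + (`|B (x, y) k| + `|B (x, y) k|).
    by ring.
  by apply: ltrD; apply: ltrD; apply: L; rewrite !inE eqxx ?orbT.
by rewrite -E ltxx in T.
Qed.

Let nxt (k : nat) (s : R * R) : R * R :=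
  match pselect (subrect s k) with
  | left P => projT1 (cid (step P))
  | right _ => s
  end.

(** The lower left corners of the nested rectangles. *)
Let S := fix S k := if k is k'.+1 then nxt k' (S k') else (x0, y0).

Let S_sub k : subrect (S k) k.
Proof.
elim: k => [|k IH] /=; first by rewrite /subrect /= expr0 !divr1.
rewrite /nxt; case: pselect => // P.
by case: (projT2 (cid (step P))).
Qed.

Let S_step k : [/\ (S k).1 <= (S k.+1).1,
  (S k.+1).1 + w / 2 ^+ k.+1 <= (S k).1 + w / 2 ^+ k,
  (S k).2 <= (S k.+1).2,  (S k.+1).2 + h / 2 ^+ k.+1 <= (S k).2 + h / 2 ^+ k
  & `|B (S k) k| <= 4 * `|B (S k.+1) k.+1|].
Proof.
rewrite [S k.+1]/= /nxt; case: pselect => [P|]; last by have := S_sub k.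
by case: (projT2 (cid (step P))) => ? ? ? [].
Qed.

Let S_mono k m : [/\ (S k).1 <= (S (m + k)).1,
  (S (m + k)).1 + w / 2 ^+ (m + k) <= (S k).1 + w / 2 ^+ k,
  (S k).2 <= (S (m + k)).2 &  (S (m + k)).2 + h / 2 ^+ (m + k) <= (S k).2 + h / 2 ^+ k].
Proof.
elim: m => [|m [a b c d]]; first by split.
have [a' b' c' d' _] := S_step (m + k).
rewrite addSn; split;
  by [exact: le_trans a'|exact: le_trans b|exact: le_trans c'|exact: le_trans d].
Qed.

Let S_cross k l : (S k).1 <= (S l).1 + w / 2 ^+ l /\ (S k).2 <= (S l).2 + h / 2 ^+ l.
Proof.
have [/subnK e|/ltnW/subnK e] := leqP k l.
  have [a _ b _] := S_mono k (l - k); rewrite e in a b.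
  by rewrite (le_trans a) ?(le_trans b) ?lerDl.
have [_ a _ b] := S_mono l (k - l); rewrite e in a b.
by split; [apply: le_trans a|apply: le_trans b]; rewrite lerDl.
Qed.

Let p : C := (sup (range (fun k => (S k).1))) +i* (sup (range (fun k => (S k).2))).

Let p_in k : inrect (S k).1 ((S k).1 + w / 2 ^+ k) (S k).2 ((S k).2 + h / 2 ^+ k) p.
Proof.
apply/and4P; split => /=.
- apply: ub_le_sup; last by exists k.
  by exists ((S 0).1 + w / 2 ^+ 0) => _ [m _ <-]; have [] := S_cross m 0.
- apply: ge_sup; first by exists (S 0).1, 0.
  by move=> _ [m _ <-]; have [] := S_cross m k.
- apply: ub_le_sup; last by exists k.
  by exists ((S 0).2 + h / 2 ^+ 0) => _ [m _ <-]; have [] := S_cross m 0.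
- apply: ge_sup; first by exists (S 0).2, 0.
  by move=> _ [m _ <-]; have [] := S_cross m k.
Qed.

Let S_pow k : `|B (S 0) 0| <= 4 ^+ k * `|B (S k) k|.
Proof.
elim: k => [|k IH]; first by rewrite expr0 mul1r.
apply: le_trans IH _; rewrite exprSr -mulrA ler_pM2l ?exprn_gt0 //.
by have [] := S_step k.
Qed.

Lemma goursat_bisection : bint f x0 (x0 + w) y0 (y0 + h) = 0.
Proof.
have -> : bint f x0 (x0 + w) y0 (y0 + h) = B (S 0) 0 by rewrite /B /= expr0 !divr1.
apply/eqP; rewrite -normr_eq0; apply/negPn/negP => I0.
have dp : differentiable f p.
  by apply: df; have := p_in 0; rewrite /= expr0 !divr1.
have [d dP] := differentiable_estimate dp.
have [I I_gt0 IE] : exists2 I : R, 0 < I & `|B (S 0) 0| = I%:C.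
  by apply: posC_ex; rewrite lt_def I0 normr_ge0.
have wh0 : 0 <= (w + h) ^+ 2 by exact: sqr_ge0.
have [e e0 eI] : exists2 e : R, 0 < e & e * (8 * ((w + h) ^+ 2 + 1)) = I.
  have q0 : 0 < 8 * ((w + h) ^+ 2 + 1) by rewrite mulr_gt0 // ltr_wpDl.
  by exists (I / (8 * ((w + h) ^+ 2 + 1))); rewrite ?divr_gt0 // divfK // gt_eqF.
have [r r0 rP] := dP _ e0.
have [k kP] : exists k, (w + h) / 2 ^+ k < r.
  have := @cvg_geometric R (w + h) 2^-1; rewrite ger0_norm ?invr_ge0 // invf_lt1 // ltr1n => /(_ isT).
  move=> /cvgrPdist_lt/(_ _ r0)[k _ /(_ k (leqnn _))] /=; rewrite sub0r normrN => Hk.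
  by exists k; apply: le_lt_trans Hk; rewrite exprVn ler_norm.
have [sl sr sb st] := S_sub k.
have cf : contframe (S k).1 ((S k).1 + w / 2 ^+ k) (S k).2 ((S k).2 + h / 2 ^+ k) f.
  exact: cont_sub.
(* [g] is the error of the affine approximation at [p]: on the boundary of the
   k-th rectangle it is at most e (w + h) / 2^k, so 4^k times its integral is at
   most 4 e (w + h)^2, less than I by the choice of [e]. *)
pose aff z := f p - d * p + d * z.
have caff : contframe (S k).1 ((S k).1 + w / 2 ^+ k) (S k).2 ((S k).2 + h / 2 ^+ k) aff.
  move=> z _; apply: continuousC_D; first exact: cst_continuous.
  by apply: continuousC_M; [exact: cst_continuous|exact: cvg_id].
pose g z := f z + (- 1) * aff z.
have cN : contframe (S k).1 ((S k).1 + w / 2 ^+ k) (S k).2 ((S k).2 + h / 2 ^+ k)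
    (fun z => - 1 * aff z).
  by move=> z zQ; apply: continuousC_M; [exact: cst_continuous|exact: caff].
have cg : contframe (S k).1 ((S k).1 + w / 2 ^+ k) (S k).2 ((S k).2 + h / 2 ^+ k) g.
  by move=> z zQ; apply: continuousC_D; [exact: cf|exact: cN].
have BE : B (S k) k = bint g (S k).1 ((S k).1 + w / 2 ^+ k) (S k).2 ((S k).2 + h / 2 ^+ k).
  have xw : (S k).1 <= (S k).1 + w / 2 ^+ k by rewrite lerDl.
  have yh : (S k).2 <= (S k).2 + h / 2 ^+ k by rewrite lerDl.
  by rewrite (bintD xw yh cf cN) (bintZ xw yh _ caff) (bint_affine xw yh) mulr0 addr0.
have : `|B (S k) k| <= (4 * (e * ((w + h) / 2 ^+ k)) * ((w + h) / 2 ^+ k))%:C.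
  rewrite BE.
  have -> : (4 * (e * ((w + h) / 2 ^+ k)) * ((w + h) / 2 ^+ k)) =
     (4 * (e * ((w + h) / 2 ^+ k)) *
     ((S k).1 + w / 2 ^+ k - (S k).1 + ((S k).2 + h / 2 ^+ k - (S k).2))) :> R by ring.
  apply: bint_bound; rewrite ?lerDl // => z /andP[zQ _].
  have zp := normC_rect zQ (p_in k); rewrite -mulrDl in zp.
  have -> : g z = f z - (f p + d * (z - p)) by rewrite /g /aff; ring.
  apply: le_trans (rP _ _) _; first by apply: le_lt_trans zp _; rewrite ltcR.
  by rewrite rmorphM /=; apply: ler_wpM2l zp; rewrite lecR ltW.
move=> Hk; have := le_trans (S_pow k) (ler_wpM2l (exprn_ge0 k _) Hk).
rewrite IE => /(_ (ler0n _ _)).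
rewrite (_ : 4 ^+ k = (4 ^+ k)%:C :> C); last by rewrite rmorphXn rmorph_nat.
rewrite -rmorphM lecR.
have -> : 4 ^+ k * (4 * (e * ((w + h) / 2 ^+ k)) * ((w + h) / 2 ^+ k)) = 4 * e * (w + h) ^+ 2.
  have -> : 4 ^+ k = 2 ^+ k * 2 ^+ k :> R by rewrite -exprMn -natrM.
  by field; rewrite gt_eqF.
rewrite leNgt => /negP; apply.
nra.
Qed.

End Bisection.

Theorem goursat_rectangle f x0 x1 y0 y1 : x0 <= x1 -> y0 <= y1 ->
  (forall z, inrect x0 x1 y0 y1 z -> differentiable f z) ->
  bint f x0 x1 y0 y1 = 0.
Proof.
move=> x01 y01 df; rewrite -(subrKC x0 x1) -(subrKC y0 y1).
by apply: goursat_bisection; rewrite ?subr_ge0 // !subrKC.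
Qed.

End Goursat.

(** * Cauchy's formula on a square *)
Section ComplexDiff.
Variable R : realType.
Local Notation C := R[i].
Variable V : normedModType C.
Implicit Types (f g : V -> C) (z : V).

Lemma differentiableC_M f g z : differentiable f z -> differentiable g z ->
  differentiable (fun w => f w * g w) z.
Proof. exact: (@differentiableM C V f g z). Qed.

Lemma differentiableC_V f z : differentiable f z -> f z != 0 ->
  differentiable (fun w => (f w)^-1) z.
Proof. exact: (@differentiableV C V f z). Qed.

Lemma differentiableC_D f g z : differentiable f z -> differentiable g z ->
  differentiable (fun w => f w + g w) z.
Proof. exact: (@differentiableD C V C f g z). Qed.

Lemma differentiableC_cst (k : C) z : differentiable (fun=> k) z.
Proof. exact: (@differentiable_cst C V C k z). Qed.

End ComplexDiff.

Section Cauchy.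
Variable R : realType.
Local Notation C := R[i].
Implicit Types (f g : C -> C) (z w : C).

Lemma differentiableC_id z : differentiable (id : C -> C) z.
Proof. exact: ex_diff. Qed.

Lemma differentiable_shiftV z w : w != z -> differentiable (fun w => (w - z)^-1) w.
Proof.
move=> wz; apply: differentiableC_V; last by rewrite subr_eq0.
by apply: differentiableC_D; [exact: differentiableC_id|exact: differentiableC_cst].
Qed.

Lemma contframe_diff x0 x1 y0 y1 f :
  (forall z, onframe x0 x1 y0 y1 z -> differentiable f z) -> contframe x0 x1 y0 y1 f.
Proof. by move=> df z /df; exact: differentiableC_continuous. Qed.

(** Cut the large rectangle along the sides of the small one: [f] is
    differentiable on the four outer pieces, so only the inner one counts. *)
Lemma bint_deform f (x0 a b x1 y0 c d y1 : R) :
  x0 <= a -> a <= b -> b <= x1 -> y0 <= c -> c <= d -> d <= y1 ->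
  (forall z, inrect x0 x1 y0 y1 z -> ~~ [&& a < reC z, reC z < b, c < imC z & imC z < d] ->
     differentiable f z) ->
  bint f x0 x1 y0 y1 = bint f a b c d.
Proof.
move=> xa ab bx yc cd dy df.
have D (p q r s : R) : x0 <= p -> q <= x1 -> y0 <= r -> s <= y1 ->
   [|| q <= a, b <= p, s <= c | d <= r] ->
   forall z, inrect p q r s z -> differentiable f z.
  move=> ? ? ? ? sep z /and4P[? ? ? ?]; apply: df; first by apply/and4P; split; lra.
  by apply/negP => /and4P[? ? ? ?]; case/or4P : sep => ?; lra.
have F (p q r s : R) : x0 <= p -> q <= x1 -> y0 <= r -> s <= y1 ->
   p <= a -> b <= q -> r <= c -> d <= s -> contframe p q r s f.
  move=> ? ? ? ? ? ? ? ?; apply: contframe_diff => z /andP[/and4P[? ? ? ?] fz].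
  apply: df; first by apply/and4P; split; lra.
  by apply/negP => /and4P[? ? ? ?]; case/or4P : fz => /eqP; lra.
have E1 : bint f x0 x1 y0 y1 = bint f x0 a y0 y1 + bint f a x1 y0 y1.
  by apply: bint_cutx; try (apply: F); lra.
have E2 : bint f a x1 y0 y1 = bint f a b y0 y1 + bint f b x1 y0 y1.
  by apply: bint_cutx; try (apply: F); lra.
have E3 : bint f a b y0 y1 = bint f a b y0 c + bint f a b c y1.
  by apply: bint_cuty; try (apply: F); lra.
have E4 : bint f a b c y1 = bint f a b c d + bint f a b d y1.
  by apply: bint_cuty; try (apply: F); lra.
have Z1 : bint f x0 a y0 y1 = 0.
  by apply: goursat_rectangle; [lra|lra|apply: D; rewrite ?lexx ?orbT //; lra].
have Z2 : bint f b x1 y0 y1 = 0.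
  by apply: goursat_rectangle; [lra|lra|apply: D; rewrite ?lexx ?orbT //; lra].
have Z3 : bint f a b y0 c = 0.
  by apply: goursat_rectangle; [lra|lra|apply: D; rewrite ?lexx ?orbT //; lra].
have Z4 : bint f a b d y1 = 0.
  by apply: goursat_rectangle; [lra|lra|apply: D; rewrite ?lexx ?orbT //; lra].
by rewrite E1 E2 E3 E4 Z1 Z2 Z3 Z4 add0r !addr0 add0r.
Qed.

Lemma frame_normC (r : R) w : onframe (- r) r (- r) r w -> r%:C <= `|w|.
Proof.
move=> /andP[/and4P[? ? ? ?] fw]; rewrite normC_real lecR.
case/or4P : fw => /eqP fw.
- by apply: le_trans (ler_Re_normC _); rewrite fw normrN ler_norm.
- by apply: le_trans (ler_Re_normC _); rewrite fw ler_norm.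
- by apply: le_trans (ler_Im_normC _); rewrite fw normrN ler_norm.
- by apply: le_trans (ler_Im_normC _); rewrite fw ler_norm.
Qed.

(** This constant is 2 pi i. The bound [unit_index_ge4] makes it possible to
    divide by it. *)
Definition unit_index : C := bint (fun w => w^-1) (-1) 1 (-1) 1.

Lemma inv_pair_hor (u : R) :
  (u +i* (- 1))^-1 - (u +i* 1)^-1 = 0 +i* (2 / (1 + u ^+ 2)) :> C.
Proof.
have u0 : 1 + u ^+ 2 != 0 by rewrite gt_eqF // ltr_pwDl // sqr_ge0.
by simpc; rewrite sqrrN expr1n [_ + 1]addrC; congr (_ +i* _); field.
Qed.

Lemma inv_pair_ver (u : R) :
  (1 +i* u)^-1 - ((- 1) +i* u)^-1 = (2 / (1 + u ^+ 2)) +i* 0 :> C.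
Proof.
have u0 : 1 + u ^+ 2 != 0 by rewrite gt_eqF // ltr_pwDl // sqr_ge0.
by simpc; rewrite sqrrN expr1n; congr (_ +i* _); field.
Qed.

(** On opposite sides of the square the integrands combine to 2i / (1 + t^2),
    respectively 2 / (1 + t^2), which is at least 1 in norm for |t| <= 1. *)
Lemma unit_index_ge4 : 4%:C <= `|unit_index|.
Proof.
rewrite normC_real lecR; apply: le_trans (ler_Im_normC _); apply: le_trans (ler_norm _).
rewrite /unit_index bint_pair //; last first.
  apply: contframe_diff => w /frame_normC w1.
  apply: differentiableC_V; first exact: differentiableC_id.
  by rewrite -normr_gt0; apply: lt_le_trans w1; rewrite ltcR.
rewrite (eq_cint (h := fun t => 0 +i* (2 / (1 + t ^+ 2)))); last first.
  by move=> t _; rewrite inv_pair_hor.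
rewrite [X in 'i * X](eq_cint (h := fun t => (2 / (1 + t ^+ 2)) +i* 0)); last first.
  by move=> t _; rewrite inv_pair_ver.
set q := fun t : R => 2 / (1 + t ^+ 2).
have q1 (t : R) : -1 <= t <= 1 -> 1 <= q t.
  move=> /andP[? ?]; have ? : 0 < 1 + t ^+ 2 by rewrite ltr_pwDl // sqr_ge0.
  by rewrite /q ler_pdivlMr // mul1r; nra.
have cq (t : R) : {for t, continuous q}.
  apply: differentiable_continuous; apply/derivable1_diffP; rewrite /q.
  have ? : 1 + t ^+ 2 != 0 by rewrite gt_eqF // ltr_pwDl // sqr_ge0.
  by apply: derivableM; [exact: derivable_cst|apply: derivableV].
have J2 : 2 <= \int[lebesgue_measure]_(t in `[-1, 1]) q t.
  have -> : 2 = \int[lebesgue_measure]_(t in `[-1, 1]) (cst 1 t) :> R.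
    by rewrite Rint_seg_cst; lra.
  apply: le_Rintegral => //.
  - by apply: integrable_continuous_at => t _; exact: cst_continuous.
  - by apply: integrable_continuous_at => t _; exact: cq.
by rewrite /cint /=; simpc; lra.
Qed.

End Cauchy.

Section CauchyFormula.
Variable R : realType.
Local Notation C := R[i].
Implicit Types (f g : C -> C) (z w : C).

Let half : R := 2^-1.

Lemma normC_le_split z (r : R) : `|z| <= r%:C ->
  [/\ - r <= reC z, reC z <= r, - r <= imC z & imC z <= r].
Proof.
rewrite normC_real lecR => zr.
have := le_trans (ler_Re_normC z) zr; have := le_trans (ler_Im_normC z) zr.
by rewrite !ler_norml => /andP[-> ->] /andP[-> ->].
Qed.

Lemma normC_eq0_le z : (forall e : R, 0 < e -> `|z| <= e%:C) -> z = 0.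
Proof.
move=> H; apply/eqP; rewrite -normr_eq0; apply/negPn/negP => z0.
have [d d0 dE] : exists2 d : R, 0 < d & `|z| = d%:C.
  by apply: posC_ex; rewrite lt_def z0 normr_ge0.
by have := H (d / 2) (divr_gt0 d0 (ltr0n _ 2)); rewrite dE lecR; lra.
Qed.

Lemma frame_dist (r s : R) z w : `|z| <= s%:C -> onframe (- r) r (- r) r w ->
  (r - s)%:C <= `|w - z|.
Proof.
move=> zs /frame_normC wr; apply: le_trans (lerB_dist _ _).
by rewrite rmorphB; apply: lerB.
Qed.

Lemma frame_neq (r s : R) z w : `|z| <= s%:C -> s < r -> onframe (- r) r (- r) r w -> w != z.
Proof.
move=> zs sr /(frame_dist zs) wz; rewrite -subr_eq0 -normr_gt0.
by apply: lt_le_trans wz; rewrite ltcR subr_gt0.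
Qed.

Lemma half_inside z : `|z| <= half%:C ->
  [&& -1 < reC z, reC z < 1, -1 < imC z & imC z < 1].
Proof.
move=> /normC_le_split[a1 a2 a3 a4]; have hE : half = 2^-1 by [].
by apply/and4P; split; lra.
Qed.

(** The integrand is holomorphic outside of the unit square and decays like
    |w|^-2, so pushing the contour to infinity makes the integral vanish. *)
Lemma bint_decay z z' : `|z| <= half%:C -> `|z'| <= half%:C ->
  bint (fun w => (w - z)^-1 * (w - z')^-1) (-1) 1 (-1) 1 = 0.
Proof.
move=> z2 z'2; apply: normC_eq0_le => e e0.
(* On the square of half-side r the integrand is at most 4 / r^2 and the bound
   for the integral is 64 / r. *)
pose r := 2 + 64 / e.
have r2 : 2 <= r by rewrite /r lerDl divr_ge0 // ltW.
have rn0 : r != 0 by rewrite gt_eqF //; lra.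
have er : 64 <= e * r.
  by rewrite /r mulrDr mulrCA divff ?mulr1 ?gt_eqF // lerDr mulr_ge0 // ltW.
set g := fun w => _.
have dg w : w != z -> w != z' -> differentiable g w.
  by move=> wz wz'; apply: differentiableC_M; exact: differentiable_shiftV.
have -> : bint g (-1) 1 (-1) 1 = bint g (- r) r (- r) r.
  have r1 : 1 <= r by apply: le_trans r2; rewrite ler1n.
  have r1' : - r <= -1 by rewrite lerN2.
  have le11 : -1 <= 1 :> R by lra.
  apply/esym; apply: bint_deform;
    [exact: r1'|exact: le11|exact: r1|exact: r1'|exact: le11|exact: r1|].
  by move=> w _ out; apply: dg; apply: contraNneq out => ->; exact: half_inside.
have s0 : half < r by apply: lt_le_trans r2; rewrite /half; lra.
apply: le_trans (bint_bound (M := 4 / r ^+ 2) _ _ _ _) _; [lra|lra| | |].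
- by apply: contframe_diff => w wr; apply: dg; [exact: frame_neq z2 s0 wr|exact: frame_neq z'2 s0 wr].
- move=> w wr.
  have F (u : C) : `|u| <= half%:C -> `|(w - u)^-1| <= (2 / r)%:C.
    move=> u2; have := frame_dist u2 wr => H.
    have rr : 0 < r / 2 by lra.
    have H2 : (r / 2)%:C <= `|w - u|.
      by apply: le_trans H; rewrite lecR; have hE : half = 2^-1 by []; lra.
    rewrite normfV (_ : (2 / r)%:C = ((r / 2)%:C)^-1); last first.
      by rewrite -fmorphV invf_div.
    have r20 : 0 < (r / 2)%:C :> C by rewrite ltcR.
    by rewrite lef_pV2 // posrE // (lt_le_trans r20).
  have -> : 4 / r ^+ 2 = 2 / r * (2 / r) by field.
  rewrite normrM rmorphM.
  by apply: ler_pM => //; exact: F.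
rewrite lecR (_ : 4 * (4 / r ^+ 2) * (r - - r + (r - - r)) = 64 / r); last by field.
by rewrite ler_pdivrMr //; lra.
Qed.

Lemma frame1_half z w : `|z| <= half%:C -> onframe (-1) 1 (-1) 1 w -> w != z.
Proof. by move=> z2; apply: (frame_neq z2); rewrite /half; lra. Qed.

Lemma normC0_half : `|0 : C| <= half%:C.
Proof. by rewrite normr0 lecR /half; lra. Qed.

(** The integral of 1/(w - z) is independent of z, since
    1/(w - z) - 1/w = z / ((w - z) w) integrates to 0 by [bint_decay]. *)
Lemma bint_index z : `|z| <= half%:C ->
  bint (fun w => (w - z)^-1) (-1) 1 (-1) 1 = unit_index R.
Proof.
move=> z2.
have le11 : -1 <= 1 :> R by lra.
have dz : contframe (-1) 1 (-1) 1 (fun w => w^-1 : C).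
  apply: contframe_diff => w /(frame1_half normC0_half) w0.
  by apply: differentiableC_V => //; exact: differentiableC_id.
have dp : contframe (-1) 1 (-1) 1 (fun w => (w - z)^-1 * (w - 0)^-1).
  apply: contframe_diff => w w1.
  by apply: differentiableC_M; apply: differentiable_shiftV; apply: frame1_half w1 => //;
    exact: normC0_half.
have dzp : contframe (-1) 1 (-1) 1 (fun w => z * ((w - z)^-1 * (w - 0)^-1)).
  by move=> w wf; apply: continuousC_M; [exact: cst_continuous|exact: dp].
transitivity (bint (fun w => w^-1 + z * ((w - z)^-1 * (w - 0)^-1)) (-1) 1 (-1) 1).
  apply: eq_bint => // w w1; rewrite subr0.
  have wz := frame1_half z2 w1; have w0 := frame1_half normC0_half w1.
  by field; rewrite w0 subr_eq0 wz.
rewrite (bintD le11 le11 dz dzp) (bintZ le11 le11 z dp) bint_decay ?mulr0 ?addr0 //.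
exact: normC0_half.
Qed.

Lemma inrect_sub (a b c d x0 x1 y0 y1 : R) w :
  x0 <= a -> b <= x1 -> y0 <= c -> d <= y1 ->
  inrect a b c d w -> inrect x0 x1 y0 y1 w.
Proof.
move=> xa bx yc dy /and4P[aw wb cw wd].
by rewrite /inrect (le_trans xa) // (le_trans wb) // (le_trans yc) // (le_trans wd).
Qed.

Lemma frame_around (h : R) z w : 0 < h ->
  onframe (reC z - h) (reC z + h) (imC z - h) (imC z + h) w ->
  w != z /\ `|w - z| <= (2 * h)%:C.
Proof.
move=> h0 /andP[wR wF]; split.
  by apply: contraTneq wF => ->; apply/negP => /or4P[] /eqP; lra.
case/and4P: wR => ? ? ? ?.
rewrite (le_trans (normC_le_ReIm _)) // lecR !raddfB /= mulr_natl mulr2n.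
by apply: lerD; rewrite ler_norml; apply/andP; split; lra.
Qed.

Lemma small_half_side (r e M : R) : 0 < r -> 0 < e -> 0 < M ->
  exists2 h : R, 0 < h & [/\ h <= half, 2 * h < r & 16 * M * h <= e].
Proof.
move=> r0 e0 M0; have M16 : 0 < 16 * M by rewrite mulr_gt0.
exists (Num.min half (Num.min (r / 3) (e / (16 * M)))).
  by rewrite !lt_min invr_gt0 ltr0n /= !divr_gt0.
set h := Num.min _ _.
have h1 : h <= half by rewrite ge_min lexx.
have h2 : h <= r / 3 by rewrite !ge_min lexx orbT.
have h3 : h <= e / (16 * M) by rewrite !ge_min lexx !orbT.
by split; [|lra|rewrite mulrC -ler_pdivlMr].
Qed.

(** The difference quotient is bounded near [z], so shrinking the contour to [z]
    makes its integral vanish. *)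
Lemma bint_slope f z : (forall w, inrect (-1) 1 (-1) 1 w -> differentiable f w) ->
  `|z| <= half%:C ->
  bint (fun w => (f w + - f z) * (w - z)^-1) (-1) 1 (-1) 1 = 0.
Proof.
move=> df z2; set g := fun w => _.
have dg w : inrect (-1) 1 (-1) 1 w -> w != z -> differentiable g w.
  move=> w1 wz; apply: differentiableC_M; last exact: differentiable_shiftV.
  by apply: differentiableC_D; [exact: df|exact: differentiableC_cst].
have [d dP] : exists d : C, forall e : R, 0 < e -> exists2 r : R, 0 < r &
    forall w, `|w - z| < r%:C -> `|f w - (f z + d * (w - z))| <= e%:C * `|w - z|.
  apply: differentiable_estimate; apply: df; have [? ? ? ?] := normC_le_split z2.
  have hE : half = 2^-1 by [].
  by clear z2 dg; apply/and4P; split; lra.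
have [r r0 rP] := dP 1 ltr01.
pose M : R := reC `|d| + 1.
have M0 : 0 < M by rewrite ltr_wpDl // -lecR -normC_real normr_ge0.
apply: normC_eq0_le => e e0.
have [h h0 [h1 h2 h3]] := small_half_side r0 e0 M0.
have [x0 x1 y0 y1] : [/\ -1 <= reC z - h, reC z + h <= 1, -1 <= imC z - h & imC z + h <= 1].
  have [a1 a2 a3 a4] := normC_le_split z2; have hE : half = 2^-1 by [].
  by clear -h0 h1 hE a1 a2 a3 a4; split; lra.
have hh (a : R) : a - h <= a + h by rewrite lerBlDr -addrA lerDl addr_ge0 // ltW.
have out w : inrect (-1) 1 (-1) 1 w ->
    ~~ [&& reC z - h < reC w, reC w < reC z + h, imC z - h < imC w & imC w < imC z + h] ->
    differentiable g w.
  by move=> w1 wo; apply: dg w1 _; apply: contraNneq wo => ->; rewrite !ltrBlDr !ltrDl h0.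
rewrite (bint_deform x0 (hh _) x1 y0 (hh _) y1 out).
have fin w : onframe (reC z - h) (reC z + h) (imC z - h) (imC z + h) w ->
    [/\ inrect (-1) 1 (-1) 1 w, w != z & `|w - z| < r%:C].
  move=> wF; have [wz wd] := frame_around h0 wF; split=> //.
    by case/andP: wF => wR _; exact: inrect_sub wR.
  by apply: le_lt_trans wd _; rewrite ltcR.
apply: le_trans (bint_bound (M := M) (hh _) (hh _) _ _) _.
- by apply: contframe_diff => w /fin[? ? _]; exact: dg.
- move=> w /fin[_ wz wr]; rewrite /g normrM normfV ler_pdivrMr ?normr_gt0 ?subr_eq0 //.
  have -> : f w + - f z = (f w - (f z + d * (w - z))) + d * (w - z) by ring.
  have -> : M%:C = 1%:C + `|d| by rewrite [`|d|]normC_real -rmorphD /M addrC.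
  apply: le_trans (ler_normD _ _) _; rewrite mulrDl normrM.
  by apply: lerD => //; exact: rP.
by rewrite lecR; apply: le_trans h3; rewrite le_eqVlt; apply/orP; left; apply/eqP; ring.
Qed.

Lemma cauchy_formula f z : (forall w, inrect (-1) 1 (-1) 1 w -> differentiable f w) ->
  `|z| <= half%:C ->
  bint (fun w => f w * (w - z)^-1) (-1) 1 (-1) 1 = unit_index R * f z.
Proof.
move=> df z2; have le11 : -1 <= 1 :> R by lra.
have cS : contframe (-1) 1 (-1) 1 (fun w => (w - z)^-1).
  by apply: contframe_diff => w /(frame1_half z2) wz; exact: differentiable_shiftV.
have cfS : contframe (-1) 1 (-1) 1 (fun w => f w * (w - z)^-1).
  move=> w wf; apply: continuousC_M (cS w wf).
  by apply: differentiableC_continuous; apply: df; case/andP: wf.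
have ckS : contframe (-1) 1 (-1) 1 (fun w => - f z * (w - z)^-1).
  by move=> w wf; apply: continuousC_M (cS w wf); exact: cst_continuous.
have := bint_slope df z2.
rewrite (_ : (fun w => _) = fun w => f w * (w - z)^-1 + - f z * (w - z)^-1); last first.
  by apply/funext => w; rewrite mulrDl.
rewrite (bintD le11 le11 cfS ckS) (bintZ le11 le11 _ cS) bint_index // mulNr.
by move=> /subr0_eq ->; rewrite mulrC.
Qed.

(** The k-th Taylor coefficient of [f] at 0. *)
Definition cauchy_coef f k : C :=
  (unit_index R)^-1 * bint (fun w => f w * w^-1 ^+ k.+1) (-1) 1 (-1) 1.

Lemma unit_index_neq0 : unit_index R != 0.
Proof. by rewrite -normr_gt0; apply: lt_le_trans (unit_index_ge4 R); rewrite ltcR. Qed.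

(** Insert 1/(w - z) = 1/w + z/w^2 + z^2/w^3 + z^3/(w^3 (w - z)) in Cauchy's
    formula. The constant 16 is universal, which is what makes the expansion
    uniform over families of holomorphic functions bounded by [B]. *)
Theorem cauchy_taylor2 f z (B : R) :
  (forall w, inrect (-1) 1 (-1) 1 w -> differentiable f w) ->
  (forall w, inrect (-1) 1 (-1) 1 w -> `|f w| <= B%:C) ->
  `|z| <= half%:C ->
  `|f z - (cauchy_coef f 0 + z * cauchy_coef f 1 + z ^+ 2 * cauchy_coef f 2)|
    <= (16 * B)%:C * `|z| ^+ 3.
Proof.
move=> df fB z2; have le11 : -1 <= 1 :> R by lra.
have onin w : onframe (-1) 1 (-1) 1 w -> inrect (-1) 1 (-1) 1 w by case/andP.
have B0 : 0 <= B.
  have : `|f 0| <= B%:C by apply: fB; apply/and4P; rewrite /=; split; lra.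
  by move/(le_trans (normr_ge0 _)); rewrite lecR.
have cinv : contframe (-1) 1 (-1) 1 (fun w => w^-1 : C).
  apply: contframe_diff => w /(frame1_half normC0_half) w0.
  by apply: differentiableC_V => //; exact: differentiableC_id.
have cX k : contframe (-1) 1 (-1) 1 (fun w => w^-1 ^+ k : C).
  elim: k => [|k IH] w wf; first exact: cst_continuous.
  rewrite (_ : (fun w => _) = (fun w => w^-1 * w^-1 ^+ k)); last by apply/funext => u; rewrite exprS.
  by apply: continuousC_M; [exact: cinv|exact: IH].
have cf : contframe (-1) 1 (-1) 1 f.
  by move=> w wf; apply: differentiableC_continuous; exact/df/onin.
have cfX k : contframe (-1) 1 (-1) 1 (fun w => f w * w^-1 ^+ k).
  by move=> w wf; apply: continuousC_M; [exact: cf|exact: cX].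
have ck k (F : C -> C) : contframe (-1) 1 (-1) 1 F -> contframe (-1) 1 (-1) 1 (fun w => k * F w).
  by move=> cF w wf; apply: continuousC_M; [exact: cst_continuous|exact: cF].
have cD (F G : C -> C) : contframe (-1) 1 (-1) 1 F -> contframe (-1) 1 (-1) 1 G ->
    contframe (-1) 1 (-1) 1 (fun w => F w + G w).
  by move=> cF cG w wf; apply: continuousC_D; [exact: cF|exact: cG].
pose h w := f w * w^-1 ^+ 3 * (w - z)^-1.
have ch : contframe (-1) 1 (-1) 1 h.
  move=> w wf; apply: continuousC_M; first exact: cfX.
  by apply: differentiableC_continuous; apply: differentiable_shiftV; exact: frame1_half z2 wf.
have E : unit_index R * f z = bint (fun w => f w * w^-1 ^+ 1) (-1) 1 (-1) 1 +
   z * bint (fun w => f w * w^-1 ^+ 2) (-1) 1 (-1) 1 +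
   z ^+ 2 * bint (fun w => f w * w^-1 ^+ 3) (-1) 1 (-1) 1 + z ^+ 3 * bint h (-1) 1 (-1) 1.
  rewrite -cauchy_formula //.
  rewrite -(bintZ le11 le11 z (cfX 2)) -(bintZ le11 le11 (z ^+ 2) (cfX 3)).
  rewrite -(bintZ le11 le11 (z ^+ 3) ch).
  have c1 := ck z _ (cfX 2); have c2 := ck (z ^+ 2) _ (cfX 3); have c3 := ck (z ^+ 3) _ ch.
  have c01 := cD _ _ (cfX 1) c1; have c012 := cD _ _ c01 c2.
  rewrite -(bintD le11 le11 (cfX 1) c1) -(bintD le11 le11 c01 c2) -(bintD le11 le11 c012 c3).
  apply: eq_bint => // w w1; rewrite /h.
  have wz := frame1_half z2 w1; have w0 := frame1_half normC0_half w1.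
  by field; rewrite w0 subr_eq0 wz.
have -> : f z - (cauchy_coef f 0 + z * cauchy_coef f 1 + z ^+ 2 * cauchy_coef f 2) =
    (unit_index R)^-1 * bint h (-1) 1 (-1) 1 * z ^+ 3.
  rewrite -[f z](mulKf unit_index_neq0) E /cauchy_coef.
  generalize (bint (fun w => f w * w^-1 ^+ 1) (-1) 1 (-1) 1).
  generalize (bint (fun w => f w * w^-1 ^+ 2) (-1) 1 (-1) 1).
  generalize (bint (fun w => f w * w^-1 ^+ 3) (-1) 1 (-1) 1) (bint h (-1) 1 (-1) 1).
  by move=> *; ring.
rewrite normrM normrX; apply: ler_wpM2r; first by rewrite exprn_ge0.
rewrite normrM normfV.
have bh : `|bint h (-1) 1 (-1) 1| <= (4 * (2 * B) * ((1 - -1) + (1 - -1)))%:C.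
  apply: bint_bound => // w wf.
  have w1 : 1 <= `|w| by exact: frame_normC wf.
  have wz : half%:C <= `|w - z|.
    by apply: le_trans (frame_dist z2 wf); rewrite lecR /half; lra.
  have hp : 0 < half%:C :> C by rewrite ltcR /half; lra.
  rewrite /h (normrM (f w * _)) (normrM (f w)) (_ : `|w^-1 ^+ 3| = `|w|^-1 ^+ 3);
    last by rewrite normrX normfV.
  rewrite normfV (_ : 2 * B = B * 1 * 2); last by ring.
  rewrite !rmorphM rmorph1; apply: ler_pM => //.
  - apply: ler_pM => //; first exact/fB/onin.
    by rewrite exprn_ile1 ?invr_ge0 // invf_le1 // (lt_le_trans ltr01).
  - rewrite [leRHS](_ : _ = (half%:C)^-1); last by rewrite -fmorphV /half invrK.
    by rewrite lef_pV2 // posrE (lt_le_trans hp).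
rewrite ler_pdivrMl; last by rewrite normr_gt0 unit_index_neq0.
apply: le_trans bh _.
apply: (@le_trans _ _ (4%:C * (16 * B)%:C)).
  by rewrite -rmorphM lecR; lra.
apply: ler_wpM2r (unit_index_ge4 R).
by rewrite lecR mulr_ge0.
Qed.

End CauchyFormula.

(** * Expansions with a uniform error bound *)
Section Expansions.
Variable R : realType.
Local Notation C := R[i].

(** Used to identify coefficients of two expansions of the same function. *)
Lemma linear_squeeze (W : normedModType C) (x : W) (r K : R) : 0 < r ->
  (forall t : R, 0 < t -> t <= r -> `|x| <= (K * t)%:C) -> x = 0.
Proof.
move=> r0 H; apply/eqP; rewrite -normr_eq0; apply/negPn/negP => x0.
have [d d0 dE] : exists2 d : R, 0 < d & `|x| = d%:C.
  by apply: posC_ex; rewrite lt_def x0 normr_ge0.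
have K0 : 0 < K.
  have := H r r0 (lexx _); rewrite dE lecR => h.
  by have := lt_le_trans d0 h; rewrite pmulr_lgt0.
pose t := Num.min r (d / (2 * K)).
have t0 : 0 < t by rewrite lt_min r0 divr_gt0 // mulr_gt0.
have tr : t <= r by rewrite ge_min lexx.
have td : t <= d / (2 * K) by rewrite ge_min lexx orbT.
have := H t t0 tr; rewrite dE lecR; move: td; rewrite ler_pdivlMr ?mulr_gt0 //; nra.
Qed.

(** An expansion along the line through [p] with quadratic error determines the
    derivative in its direction. *)
Lemma is_derive_expansion (V W : normedModType C) (f : V -> W) (p v : V) (a : W) (r K : R) :
  0 < r ->
  (forall t : C, `|t| <= r%:C -> `|f (p + t *: v) - f p - t *: a| <= K%:C * `|t| ^+ 2) ->
  is_derive p v f a.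
Proof.
move=> r0 H.
suff cv : (fun h => h^-1 *: ((f \o shift p) (h *: v) - f p)) @ 0^' --> a.
  by apply: DeriveDef; [apply/cvg_ex; exists a|apply: cvg_lim].
apply/cvgrPdist_le => e /posC_ex[d d0 ->].
apply/nbhs_ballP; pose s := Num.min r (d / (`|K| + 1)).
have K1 : 0 < `|K| + 1 by rewrite ltr_wpDl.
have s0 : 0 < s by rewrite lt_min r0 divr_gt0.
exists s%:C; first by rewrite /= ltcR.
move=> t; rewrite -(@ball_normE C C) /ball_ /= sub0r normrN => ts tn0.
have tr : `|t| <= r%:C by rewrite (le_trans (ltW ts)) // lecR ge_min lexx.
have -> : a - t^-1 *: (f (t *: v + p) - f p) = - (t^-1 *: (f (p + t *: v) - f p - t *: a)).
  by rewrite [in RHS]scalerBr [in RHS]scalerA mulVf // scale1r opprB [t *: v + p]addrC.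
rewrite normrN normrZ normfV ler_pdivrMl ?normr_gt0 //.
apply: le_trans (H t tr) _; rewrite [leRHS]mulrC expr2 mulrA.
apply: ler_wpM2r => //.
apply: (@le_trans _ _ ((`|K| + 1)%:C * s%:C)).
  apply: (@le_trans _ _ ((`|K| + 1)%:C * `|t|)).
    by apply: ler_wpM2r => //; rewrite lecR (le_trans (ler_norm _)) // lerDl.
  by apply: ler_wpM2l (ltW ts); rewrite lecR ltW.
rewrite -rmorphM lecR -ler_pdivlMl // mulrC.
by rewrite ge_min lexx orbT.
Qed.

Lemma differentiable_quadratic (V W : normedModType C) (f : V -> W) (p : V) (r K : R) :
  0 < r -> f p = 0 ->
  (forall h : V, `|h| <= r%:C -> `|f (p + h)| <= K%:C * `|h| ^+ 2) ->
  differentiable f p.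
Proof.
move=> r0 fp H.
have E : f \o shift p = cst (f p) + (\0 : {linear V -> W}) +o_ (0 : V) id.
  apply/eqaddoP => e /posC_ex[d d0 ->]; apply/near_normC.
  have K1 : 0 < `|K| + 1 by rewrite ltr_wpDl.
  exists (Num.min r (d / (`|K| + 1))); first by rewrite lt_min r0 divr_gt0.
  move=> h; rewrite subr0 => hs.
  rewrite !fctE /= fp !add0r subr0 [h + p]addrC.
  have hr : `|h| <= r%:C by rewrite (le_trans (ltW hs)) // lecR ge_min lexx.
  apply: le_trans (H h hr) _; rewrite expr2 mulrA; apply: ler_wpM2r => //.
  apply: (@le_trans _ _ ((`|K| + 1)%:C * (Num.min r (d / (`|K| + 1)))%:C)).
    apply: (@le_trans _ _ ((`|K| + 1)%:C * `|h|)).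
      by apply: ler_wpM2r => //; rewrite lecR (le_trans (ler_norm _)) // lerDl.
    by apply: ler_wpM2l (ltW hs); rewrite lecR ltW.
  rewrite -rmorphM lecR -ler_pdivlMl // mulrC.
  by rewrite ge_min lexx orbT.
have c0 : continuous (\0 : {linear V -> W}) by move=> x; exact: cst_continuous.
have fd := diff_unique c0 E.
by apply/diff_locallyP; rewrite fd; split.
Qed.

End Expansions.

(** The values at p + tu + tv and p + tu - tv, called [a] and [b], are expanded
    once at p, in the directions u + v and u - v, and once at p + tu, in the
    directions v and -v. The difference of the two expansions isolates the
    increment of D_v f from p to p + tu. *)
Lemma second_difference (R : realType) (t a b c Lq P Lu Lv A Q1 Q2 : R[i]) :
  t * (Lq - Lv - t * ((Q1 - Q2) / 2)) =
  ((a - (P + t * (Lu + Lv) + t ^+ 2 * Q1) - (b - (P + t * (Lu - Lv) + t ^+ 2 * Q2)))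
   - (a - (c + t * Lq + t ^+ 2 * A) - (b - (c + - t * Lq + t ^+ 2 * A)))) / 2.
Proof. by field. Qed.

(** * The second derivative of a holomorphic function of several variables *)
Section SecondOrder.
Variable R : realType.
Local Notation C := R[i].
Variables (V : normedModType C) (f : V -> C) (p : V) (rho B : R).
(* The factor 8 leaves room for complex lines in directions of length 2 rho
   through points at distance 2 rho from [p], with parameter |t| <= 2. *)
Hypothesis rho0 : 0 < rho.
Hypothesis df : forall q, `|q - p| <= (8 * rho)%:C -> differentiable f q.
Hypothesis fB : forall q, `|q - p| <= (8 * rho)%:C -> `|f q| <= B%:C.
Implicit Types (q u v : V) (t : C).

Let half : R := 2^-1.
Let L q v : C := 'D_v f q.

Let B0 : 0 <= B.
Proof.
have := fB (q := p); rewrite subrr normr0 lecR mulr_ge0 ?(ltW rho0) // => /(_ isT).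
by move/(le_trans (normr_ge0 _)); rewrite lecR.
Qed.

Let normM2 (a b : R) t v : `|t| <= a%:C -> `|v| <= b%:C -> `|t *: v| <= (a * b)%:C.
Proof. by move=> ta vb; rewrite normrZ rmorphM; apply: ler_pM. Qed.

Let normD2 (a b : R) u v : `|u| <= a%:C -> `|v| <= b%:C -> `|u + v| <= (a + b)%:C.
Proof. by move=> ta vb; rewrite (le_trans (ler_normD _ _)) // rmorphD lerD. Qed.

Lemma diff_line q v t : differentiable (fun s : C => q + s *: v) t.
Proof.
apply: (@differentiableD C C V (cst q) (fun s : C => s *: v)).
  exact: differentiable_cst.
exact: differentiableZl.
Qed.

(** [cauchy_taylor2] for t |-> f (q + t v). The error bound depends neither on
    [q] nor on [v]. *)
Lemma taylor_line q v : `|q - p| <= (2 * rho)%:C -> `|v| <= (2 * rho)%:C ->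
  exists A : C, forall t, `|t| <= half%:C ->
    `|f (q + t *: v) - (f q + t * L q v + t ^+ 2 * A)| <= (16 * B)%:C * `|t| ^+ 3.
Proof.
move=> qp v2; pose phi t := f (q + t *: v).
have inb t : inrect (-1) 1 (-1) 1 t -> `|q + t *: v - p| <= (8 * rho)%:C.
  move=> /and4P[? ? ? ?].
  have tv : `|t *: v| <= (2 * (2 * rho))%:C.
    apply: normM2 => //; rewrite (le_trans (normC_le_ReIm _)) // lecR (_ : 2 = 1 + 1) //.
    by apply: lerD; rewrite ler_norml; apply/andP; split; lra.
  rewrite addrAC; apply: le_trans (normD2 qp tv) _.
  by rewrite lecR; have := ltW rho0; lra.
have dphi t : inrect (-1) 1 (-1) 1 t -> differentiable phi t.
  by move=> /inb qt; apply: differentiable_comp; [exact: diff_line|exact: df].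
have bphi t : inrect (-1) 1 (-1) 1 t -> `|phi t| <= B%:C by move=> /inb /fB.
pose a0 := cauchy_coef phi 0; pose a1 := cauchy_coef phi 1; pose a2 := cauchy_coef phi 2.
have T t : `|t| <= half%:C -> `|phi t - (a0 + t * a1 + t ^+ 2 * a2)| <= (16 * B)%:C * `|t| ^+ 3.
  exact: (cauchy_taylor2 dphi bphi).
have e0 : f q = a0.
  have := T 0 (normC0_half R); rewrite /phi scale0r addr0 normr0 !expr0n /= !mul0r !addr0 mulr0.
  by rewrite normr_le0 subr_eq0 => /eqP.
have e1 : L q v = a1.
  have := @is_derive_expansion R V C f q v a1 half (reC `|a2| + 8 * B); rewrite invr_gt0 ltr0n.
  move=> /(_ isT) H; apply: derive_val; apply: H => t t2.
  have -> : f (q + t *: v) - f q - t *: a1 = (phi t - (a0 + t * a1 + t ^+ 2 * a2)) + t ^+ 2 * a2.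
    by rewrite /phi -e0 (_ : t *: a1 = t * a1) //; ring.
  apply: le_trans (ler_normD _ _) _.
  have -> : (reC `|a2| + 8 * B)%:C = (8 * B)%:C + `|a2| by rewrite [`|a2|]normC_real -rmorphD addrC.
  rewrite mulrDl (normrM (t ^+ 2)) normrX [`|t| ^+ 2 * _]mulrC; apply: lerD => //.
  apply: le_trans (T t t2) _.
  rewrite exprSr mulrA mulrAC.
  have -> : (8 * B)%:C = (16 * B)%:C * half%:C by rewrite -rmorphM; congr (_%:C); rewrite /half; lra.
  apply: ler_wpM2r; first exact: exprn_ge0.
  by apply: ler_wpM2l => //; rewrite lecR mulr_ge0.
by exists a2 => t t2; rewrite e0 e1; exact: T.
Qed.

Let pp : `|p - p| <= (2 * rho)%:C.
Proof. by rewrite subrr normr0 lecR mulr_ge0 // ltW. Qed.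

Lemma second_coef q v : exists A : C,
  `|q - p| <= (2 * rho)%:C -> `|v| <= (2 * rho)%:C -> forall t, `|t| <= half%:C ->
    `|f (q + t *: v) - (f q + t * L q v + t ^+ 2 * A)| <= (16 * B)%:C * `|t| ^+ 3.
Proof.
have [[H1 H2]|H] := pselect (`|q - p| <= (2 * rho)%:C /\ `|v| <= (2 * rho)%:C).
  by have [A HA] := taylor_line H1 H2; exists A.
by exists 0 => H1 H2; case: H.
Qed.

(** The second Taylor coefficient of [f] at [q] along the direction [v], that is,
    half of the second derivative; it is meaningful for [q] near [p] and small
    [v]. *)
Definition quad q v : C := projT1 (cid (second_coef q v)).

Lemma quadP q v t : `|q - p| <= (2 * rho)%:C -> `|v| <= (2 * rho)%:C -> `|t| <= half%:C ->
    `|f (q + t *: v) - (f q + t * L q v + t ^+ 2 * quad q v)| <= (16 * B)%:C * `|t| ^+ 3.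
Proof. by move=> q2 v2; apply: (projT2 (cid (second_coef q v)) q2 v2). Qed.

Lemma normN_le v (r : R) : `|v| <= r%:C -> `|- v| <= r%:C.
Proof. by rewrite normrN. Qed.

Let LE q : `|q - p| <= (2 * rho)%:C -> forall u, L q u = 'd f q u.
Proof.
move=> qp u; rewrite /L deriveE //; apply: df; apply: le_trans qp _.
by rewrite lecR; have := ltW rho0; lra.
Qed.

Let LN v : L p (- v) = - L p v.
Proof. by rewrite !(LE pp) raddfN. Qed.

Lemma quadN v : `|v| <= (2 * rho)%:C -> quad p (- v) = quad p v.
Proof.
move=> v2; apply/eqP; rewrite -subr_eq0; apply/eqP.
apply: (@linear_squeeze R C _ half (32 * B)); first by rewrite invr_gt0.
move=> t t0 th.
have tE : `|t%:C| = t%:C by rewrite ger0_norm // lecR ltW.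
have t2 : `|t%:C| <= half%:C by rewrite tE lecR.
have N2 : `|- t%:C| <= half%:C by rewrite normrN.
have H1 := quadP pp v2 t2.
have := quadP pp (normN_le v2) N2; rewrite scaleNr scalerN opprK LN normrN sqrrN => H2.
have := le_trans (ler_normB _ _) (lerD H1 H2).
set X := (X in `|X|); have -> : X = t%:C ^+ 2 * (quad p (- v) - quad p v) by rewrite /X; ring.
rewrite normrM normrX tE -mulrDl -rmorphD => H3.
have t2p : 0 < t%:C ^+ 2 :> C by rewrite exprn_gt0 // ltcR.
rewrite -(ler_pM2l t2p); apply: le_trans H3 _.
by rewrite -!rmorphXn -!rmorphM lecR; rewrite le_eqVlt; apply/orP; left; apply/eqP; ring.
Qed.

(** The polarization of the quadratic form 2 [quad p]: this is D_u D_v f (p). *)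
Definition hess u v : C := (quad p (u + v) - quad p (u - v)) / 2.

Lemma hessC u v : `|u| <= rho%:C -> `|v| <= rho%:C -> hess u v = hess v u.
Proof.
move=> ur vr; rewrite /hess [v + u]addrC -[v - u]opprB quadN //.
by apply: le_trans (normD2 ur (normN_le vr)) _; rewrite lecR; have := ltW rho0; lra.
Qed.

Let LD u v : L p (u + v) = L p u + L p v.
Proof. by rewrite !(LE pp) raddfD. Qed.

(** See [second_difference]. As the error is quadratic in [t], uniformly in [u],
    the derivative D_v f has the directional derivatives [hess u v] at [p]. *)
Lemma hess_expansion u v t : `|u| <= rho%:C -> `|v| <= rho%:C -> `|t| <= half%:C ->
  `|L (p + t *: u) v - L p v - t * hess u v| <= (32 * B)%:C * `|t| ^+ 2.
Proof.
move=> ur vr th; have [->|t0] := eqVneq t 0.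
  by rewrite scale0r addr0 subrr mul0r subr0 normr0 expr0n /= mulr0.
have hE : half = 2^-1 by [].
have qp : `|p + t *: u - p| <= (2 * rho)%:C.
  rewrite addrAC subrr add0r; apply: le_trans (normM2 th ur) _; rewrite lecR.
  apply: (ler_wpM2r (ltW rho0)); rewrite /half; lra.
have r2 (w : V) : `|w| <= rho%:C -> `|w| <= (2 * rho)%:C.
  by move=> wr; apply: le_trans wr _; rewrite lecR; have := ltW rho0; lra.
have Nt : `|- t| <= half%:C by rewrite normrN.
have uv : `|u + v| <= (2 * rho)%:C.
  by apply: le_trans (normD2 ur vr) _; rewrite lecR; have := ltW rho0; lra.
have umv : `|u - v| <= (2 * rho)%:C.
  by apply: le_trans (normD2 ur (normN_le vr)) _; rewrite lecR; have := ltW rho0; lra.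
have H1 := quadP qp (r2 _ vr) th; have H2 := quadP qp (r2 _ vr) Nt.
have H3 := quadP pp uv th; have H4 := quadP pp umv th.
move: H1 H2 H3 H4.
rewrite normrN sqrrN scaleNr !scalerDr !LD LN scalerN !addrA => H1 H2 H3 H4.
have E := @second_difference R t (f (p + t *: u + t *: v)) (f (p + t *: u - t *: v))
  (f (p + t *: u)) (L (p + t *: u) v) (f p) (L p u) (L p v) (quad (p + t *: u) v)
  (quad p (u + v)) (quad p (u - v)).
rewrite -(@ler_pM2l _ `|t|) ?normr_gt0 // -normrM E normrM normfV.
rewrite [X in _ / X]ger0_norm // ler_pdivrMr //.
have := le_trans (ler_normB _ _) (lerD (le_trans (ler_normB _ _) (lerD H3 H4))
  (le_trans (ler_normB _ _) (lerD H1 H2))).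
move=> H; apply: le_trans H _; rewrite !rmorphM !rmorph_nat.
by rewrite le_eqVlt; apply/orP; left; apply/eqP; rewrite [in RHS]exprS; ring.
Qed.

End SecondOrder.

(** * Partial derivatives of holomorphic functions are holomorphic *)
Section DerivedHolomorphic.
Variable R : realType.
Local Notation C := R[i].
Variables (n : nat).
Local Notation V := 'rV[C]_n.
Implicit Types (f : V -> C) (p q u v : V) (t : C).

Lemma row_sum_scaled (s : 'I_n -> C) u : (forall j, s j != 0) ->
  u = \sum_j (u 0 j / s j) *: (s j *: delta_mx 0 j).
Proof.
move=> s0; rewrite [LHS]row_sum_delta; apply: eq_bigr => j _.
by rewrite scalerA divfK.
Qed.

Section Local.
Variables (f : V -> C) (p : V) (rho B : R).
Hypothesis rho0 : 0 < rho.
Hypothesis df : forall q, `|q - p| <= (8 * rho)%:C -> differentiable f q.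
Hypothesis fB : forall q, `|q - p| <= (8 * rho)%:C -> `|f q| <= B%:C.

Let H u v : C := hess rho0 df fB u v.

Let half : R := 2^-1.
Let half0 : 0 < half. Proof. by rewrite invr_gt0. Qed.

Lemma is_derive_hess u v : `|u| <= rho%:C -> `|v| <= rho%:C ->
  is_derive p u (fun q => 'D_v f q) (H u v).
Proof.
move=> ur vr; apply: (is_derive_expansion half0 (K := 32 * B)) => t th.
exact: hess_expansion ur vr th.
Qed.

Let s j : C := rho%:C / (`|delta_mx 0 j : V| + 1).
Let w j : V := s j *: delta_mx 0 j.

Let d1 j : 0 < `|delta_mx 0 j : V| + 1. Proof. by rewrite ltr_wpDl. Qed.
Let s_gt0 j : 0 < s j. Proof. by rewrite divr_gt0 // ltcR. Qed.
Let s0 j : s j != 0. Proof. by rewrite gt_eqF. Qed.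

Let wr j : `|w j| <= rho%:C.
Proof.
rewrite normrZ gtr0_norm // /s mulrAC ler_pdivrMr //.
by apply: ler_wpM2l; [rewrite lecR ltW|rewrite lerDl].
Qed.

(** D_u f is linear in [u] at each point near [p], so its derivative [H v u] along
    [v] is linear in [u] as well. The vectors [w j] are multiples of the standard
    basis vectors short enough for the expansions to apply. *)
Lemma hess_row u v : `|u| <= rho%:C -> `|v| <= rho%:C ->
  H v u = \sum_j (u 0 j / s j) * H v (w j).
Proof.
move=> ur vr.
have D1 := is_derive_hess vr ur.
have D2 := @is_derive_sum C V C n (fun j q => (u 0 j / s j) *: 'D_(w j) f q) p v
    (fun j => (u 0 j / s j) *: H v (w j))
    (fun j => @is_deriveZ C V C _ (u 0 j / s j) p v _ (is_derive_hess vr (wr j))).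
rewrite -(@derive_val _ _ _ _ _ _ _ D1) -[RHS](@derive_val _ _ _ _ _ _ _ D2).
apply: near_eq_derive; apply/near_normC; exists rho => // q qp.
have dq : differentiable f q.
  apply: df; apply: le_trans (ltW qp) _; rewrite lecR; have := ltW rho0; lra.
rewrite deriveE // {1}(row_sum_scaled u s0) raddf_sum fct_sumE; apply: eq_bigr => j _.
by rewrite [in RHS]deriveE //; exact: (linearZ_LR ('d f q)).
Qed.

(** [g] is the affine approximation of D_v f at [p] given by [H]; the remainder
    is quadratic by [hess_expansion], applied to increments h = t u with
    |u| = rho. *)
Lemma differentiable_derive_small v : `|v| <= rho%:C ->
  differentiable (fun q => 'D_v f q) p.
Proof.
move=> vr; pose c j := H v (w j) / s j.
pose g q := 'D_v f p + \sum_j (q - p) 0 j * c j.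
have dg : differentiable g p.
  apply: differentiableC_D; first exact: differentiableC_cst.
  rewrite (_ : (fun q => \sum_j (q - p) 0 j * c j) =
     \sum_j (fun q : V => (q - p) 0 j * c j)); last by apply/funext => q; rewrite fct_sumE.
  apply: differentiable_sum => j; apply: differentiableC_M; last exact: differentiableC_cst.
  apply: (@differentiable_comp C V V C (fun q => q - p) (fun q => q 0 j)) => //.
  exact: differentiable_coord.
pose r q := 'D_v f q - g q.
have rE h : r (p + h) = 'D_v f (p + h) - 'D_v f p - \sum_j h 0 j * c j.
  rewrite /r /g opprD addrA; congr (_ - _); apply: eq_bigr => j _.
  by rewrite addrAC subrr add0r.
have dr : differentiable r p.
  apply: (@differentiable_quadratic R V C r p (half * rho) (32 * B / rho ^+ 2)).
  - by rewrite mulr_gt0.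
  - rewrite -[p]addr0 rE addr0 subrr big1 ?subr0 // => j _.
    by rewrite mxE mul0r.
  move=> h hr; rewrite rE; have [->|h0] := eqVneq h 0.
    rewrite addr0 subrr big1 ?subr0 ?normr0 ?expr0n /= ?mulr0 // => j _.
    by rewrite mxE mul0r.
  have rC : 0 < rho%:C :> C by rewrite ltcR.
  pose t := `|h| / rho%:C; have t0 : 0 < t by rewrite divr_gt0 // normr_gt0.
  have tn : `|t| = t by rewrite gtr0_norm.
  pose u := t^-1 *: h.
  have hE : h = t *: u by rewrite scalerA divff ?scale1r // gt_eqF.
  have ur : `|u| <= rho%:C.
    rewrite normrZ normfV tn /t invf_div divfK //.
    by rewrite normr_eq0.
  have th : `|t| <= half%:C.
    by rewrite tn ler_pdivrMr // -rmorphM.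
  have -> : \sum_j h 0 j * c j = t * H u v.
    rewrite /H hessC // -/(H v u) (hess_row ur vr) mulr_sumr; apply: eq_bigr => j _.
    by rewrite {1}hE mxE /c; field.
  rewrite {1}hE; apply: le_trans (hess_expansion rho0 df fB ur vr th) _.
  rewrite tn /t (_ : (32 * B / rho ^+ 2)%:C = (32 * B)%:C / rho%:C ^+ 2); last first.
    by rewrite rmorphM fmorphV rmorphXn.
  by rewrite exprMn exprVn mulrA mulrAC.
rewrite (_ : (fun q => 'D_v f q) = (fun q => g q + r q)); last first.
  by apply/funext => q; rewrite /r addrC subrK.
exact: differentiableC_D.
Qed.

Lemma derive_sym_small u v : `|u| <= rho%:C -> `|v| <= rho%:C ->
  'D_u (fun q => 'D_v f q) p = 'D_v (fun q => 'D_u f q) p.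
Proof.
move=> ur vr.
have H1 := is_derive_hess ur vr.
have H2 := is_derive_hess vr ur.
have E1 := @derive_val _ _ _ _ _ _ _ H1.
have E2 := @derive_val _ _ _ _ _ _ _ H2.
transitivity (H u v).
exact: E1.
transitivity (H v u); last by exact: esym E2.
exact: hessC.
Qed.

End Local.

Lemma holo_local_bound f p : (\forall q \near p, differentiable f q) ->
  exists rho B : R, [/\ 0 < rho,
    forall q, `|q - p| <= (8 * rho)%:C -> differentiable f q
    & forall q, `|q - p| <= (8 * rho)%:C -> `|f q| <= B%:C].
Proof.
move=> df; have /differentiable_continuous cf := nbhs_singleton df.
have bf : \forall q \near p, `|f p - f q| < 1.
  by move/cvgrPdist_lt : cf; apply.
have [d d0 H] := iffLR (near_normC _ _) (filterI df bf).
exists (d / 9), (reC `|f p| + 1); split; first by rewrite divr_gt0.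
  move=> q qp; apply: (proj1 (H q _)); apply: le_lt_trans qp _; rewrite ltcR; lra.
move=> q qp; have [_ fq] : differentiable f q /\ `|f p - f q| < 1.
  by apply: H; apply: le_lt_trans qp _; rewrite ltcR; lra.
have -> : (reC `|f p| + 1)%:C = `|f p| + 1 by rewrite [`|f p|]normC_real -rmorphD.
rewrite (_ : f q = f p - (f p - f q)); last by ring.
by apply: le_trans (ler_normB _ _) _; rewrite lerD2l ltW.
Qed.

Lemma scale_small (rho : R) v : 0 < rho -> exists2 k : C, k != 0 & `|k *: v| <= rho%:C.
Proof.
move=> rho0; have v1 : 0 < `|v| + 1 by rewrite ltr_wpDl.
have k0 : 0 < rho%:C / (`|v| + 1) by rewrite divr_gt0 // ltcR.
exists (rho%:C / (`|v| + 1)); first by rewrite gt_eqF.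
rewrite normrZ gtr0_norm // mulrAC ler_pdivrMr //.
by apply: ler_wpM2l; [rewrite lecR ltW|rewrite lerDl].
Qed.

Lemma derive_scale f q v (k : C) : differentiable f q -> 'D_(k *: v) f q = k * 'D_v f q.
Proof. by move=> dq; rewrite !deriveE //; exact: (linearZ_LR ('d f q)). Qed.

Lemma near_derive_scale f p v (k : C) : k != 0 -> (\forall q \near p, differentiable f q) ->
  \forall q \near p, k^-1 * 'D_(k *: v) f q = 'D_v f q.
Proof.
by move=> k0; apply: filterS => q dq; rewrite derive_scale // mulKf.
Qed.

Theorem differentiable_derive f p v : (\forall q \near p, differentiable f q) ->
  differentiable (fun q => 'D_v f q) p.
Proof.
move=> df; have [rho [B [rho0 df' fB]]] := holo_local_bound df.
have [k k0 kv] := scale_small v rho0.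
have d : differentiable (fun q => k^-1 * 'D_(k *: v) f q) p.
  apply: differentiableC_M; first exact: differentiableC_cst.
  exact: differentiable_derive_small rho0 df' fB _ kv.
by have [] := Defs.near_eq_diff (near_derive_scale v k0 df) d.
Qed.

Let cancel_scale (a b X Y Y' Z : C) :
  a != 0 -> Y' = b^-1 * Y -> Y' = Z -> Z = a * X -> X = a^-1 * b^-1 * Y.
Proof. by move=> a0 e1 e2 e3; rewrite -mulrA -e1 e2 e3 mulKf. Qed.

Let sym_scale (a b X X' Y Y' : C) :
  X = a^-1 * b^-1 * Y -> X' = b^-1 * a^-1 * Y' -> Y = Y' -> X = X'.
Proof. by move=> -> -> ->; rewrite [b^-1 * _]mulrC. Qed.

Theorem derive_sym f p u v : (\forall q \near p, differentiable f q) ->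
  'D_u (fun q => 'D_v f q) p = 'D_v (fun q => 'D_u f q) p.
Proof.
move=> df; have [rho [B [rho0 df' fB]]] := holo_local_bound df.
have [k k0 ku] := scale_small u rho0; have [l l0 lv] := scale_small v rho0.
have S x y a b : a != 0 -> b != 0 ->
   'D_x (fun q => 'D_y f q) p = a^-1 * b^-1 * 'D_(a *: x) (fun q => 'D_(b *: y) f q) p.
  move=> a0 b0.
  have dxy z := differentiable_derive z df.
  have e : 'D_(a *: x) (fun q => b^-1 * 'D_(b *: y) f q) p = 'D_(a *: x) (fun q => 'D_y f q) p.
    exact: near_eq_derive (near_derive_scale y b0 df).
  have e2 : 'D_(a *: x) (fun q => b^-1 * 'D_(b *: y) f q) p =
      b^-1 * 'D_(a *: x) (fun q => 'D_(b *: y) f q) p.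
    exact: (@deriveZ C V C (fun q => 'D_(b *: y) f q) b^-1 p (a *: x) (diff_derivable (dxy _))).
  exact: cancel_scale a0 e2 e (derive_scale x a (dxy y)).
exact: sym_scale (S u v k l k0 l0) (S v u l k l0 k0) (derive_sym_small rho0 df' fB ku lv).
Qed.

End DerivedHolomorphic.

(** * Jacobi's formula *)
Section Jacobi.
Variable R : realType.
Local Notation C := R[i].
Variable V : normedModType C.
Implicit Types (f g : V -> C) (p v : V).

Lemma deriveC_D f g p v : differentiable f p -> differentiable g p ->
  'D_v (fun q => f q + g q) p = 'D_v f p + 'D_v g p.
Proof.
move=> df dg.
exact: (@deriveD C V C f g p v (diff_derivable df) (diff_derivable dg)).
Qed.

Lemma deriveC_M f g p v : differentiable f p -> differentiable g p ->
  'D_v (fun q => f q * g q) p = f p * 'D_v g p + g p * 'D_v f p.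
Proof. by move=> df dg; exact: (@deriveM C V f g p v (diff_derivable df) (diff_derivable dg)). Qed.

Lemma deriveC_V f p v : differentiable f p -> f p != 0 ->
  'D_v (fun q => (f q)^-1) p = - (f p)^-1 ^+ 2 * 'D_v f p.
Proof.
move=> df f0; rewrite (@deriveV C V f p v f0 (diff_derivable df)).
by rewrite exprVn.
Qed.

Lemma differentiable_big_sum (I : Type) (r : seq I) (F : I -> V -> C) p :
  (forall i, differentiable (F i) p) ->
  differentiable (fun q => \sum_(i <- r) F i q) p /\
  forall v, 'D_v (fun q => \sum_(i <- r) F i q) p = \sum_(i <- r) 'D_v (F i) p.
Proof.
move=> dF; elim: r => [|i r [dr Dr]].
  rewrite (_ : (fun q => _) = (fun=> 0)); last by apply/funext => q; rewrite big_nil.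
  split; first exact: differentiableC_cst.
  by move=> v; rewrite big_nil; exact: derive_cst.
rewrite (_ : (fun q => _) = (fun q => F i q + \sum_(i <- r) F i q)); last first.
  by apply/funext => q; rewrite big_cons.
split; first exact: differentiableC_D.
by move=> v; rewrite deriveC_D // Dr big_cons.
Qed.

Lemma differentiable_big_prod (I : eqType) (r : seq I) (F : I -> V -> C) p :
  uniq r -> (forall i, differentiable (F i) p) ->
  differentiable (fun q => \prod_(i <- r) F i q) p /\
  forall v, 'D_v (fun q => \prod_(i <- r) F i q) p =
    \sum_(i <- r) 'D_v (F i) p * \prod_(j <- r | j != i) F j p.
Proof.
move=> + dF; elim: r => [_|i r IH /= /andP[ir ur]].
  rewrite (_ : (fun q => _) = (fun=> 1)); last by apply/funext => q; rewrite big_nil.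
  split; first exact: differentiableC_cst.
  by move=> v; rewrite big_nil; exact: derive_cst.
have [dr Dr] := IH ur.
rewrite (_ : (fun q => _) = (fun q => F i q * \prod_(i <- r) F i q)); last first.
  by apply/funext => q; rewrite big_cons.
split; first exact: differentiableC_M.
move=> v; rewrite deriveC_M // Dr big_cons addrC; congr (_ + _).
  rewrite big_cons eqxx mulrC /=; congr (_ * _); rewrite big_seq [in RHS]big_seq_cond.
  by apply: eq_bigl => j; case: eqVneq => [->|]; rewrite ?(negPf ir) ?andbT.
rewrite mulr_sumr; apply: eq_big_seq => k kr.
rewrite big_cons (_ : i != k); last by apply: contraNneq ir => ->.
by rewrite mulrCA.
Qed.

(** Both sides are the sum over i of the determinant of [A] with row i replaced by
    that of [B]: expanded along row i on the left, by the Leibniz formula on the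
    right. *)
Lemma trace_adj_replace_row n (A B : 'M[C]_n) :
  \tr (\adj A *m B) =
  \sum_(s : 'S_n) (-1) ^+ s * \sum_i B i (s i) * \prod_(j | j != i) A j (s j).
Proof.
pose Ai i := \matrix_(k, l) (if k == i then B k l else A k l).
transitivity (\sum_i \det (Ai i)).
  rewrite /mxtrace; under eq_bigr do rewrite mxE.
  rewrite exchange_big /=; apply: eq_bigr => i _.
  rewrite (expand_det_row (Ai i) i); apply: eq_bigr => j _.
  rewrite [adjugate _ _ _]mxE mulrC mxE eqxx; congr (_ * _).
  rewrite /cofactor; congr (_ * \det _); apply/matrixP => k l; rewrite !mxE.
  by rewrite [_ == i]eq_sym (negPf (neq_lift _ _)).
rewrite exchange_big /=; apply: eq_bigr => s _; rewrite mulr_sumr; apply: eq_bigr => i _.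
rewrite (bigD1 i) //= mxE eqxx; congr (_ * (_ * _)).
by apply: eq_bigr => j ji; rewrite mxE (negPf ji).
Qed.

(** The right-hand side of [trace_adj_replace_row] is the derivative of the
    Leibniz formula by the product rule. *)
Lemma jacobi_formula n (A : V -> 'M[C]_n) p :
  (forall i j, differentiable (fun q => A q i j) p) ->
  differentiable (fun q => \det (A q)) p /\
  forall v, 'D_v (fun q => \det (A q)) p =
    \tr (\adj (A p) *m \matrix_(i, j) 'D_v (fun q => A q i j) p).
Proof.
move=> dA.
have P (s : 'S_n) := @differentiable_big_prod _ (index_enum _) (fun i q => A q i (s i)) p
  (index_enum_uniq _) (fun i => dA i (s i)).
have dT (s : 'S_n) : differentiable (fun q => (-1) ^+ s * \prod_i A q i (s i)) p.
  by apply: differentiableC_M; [exact: differentiableC_cst|have [] := P s].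
have [dS DS] := @differentiable_big_sum _ (index_enum _) _ p dT.
split=> // v; rewrite [LHS]DS trace_adj_replace_row; apply: eq_bigr => s _.
have [dP DP] := P s; rewrite (deriveC_M v (differentiableC_cst _ _) dP).
rewrite [X in _ + _ * X](_ : _ = 0) ?mulr0 ?addr0; last exact: derive_cst.
congr (_ * _); rewrite DP; apply: eq_bigr => i _; congr (_ * _).
by rewrite mxE.
Qed.

End Jacobi.

(** * The closed form du/u *)
(** The form du/u, normalized to 0 outside of [V] like the sections of a sheaf of
    forms. *)
HB.lock Definition dlog (R : realType) (n : nat) (X : cmanifold R n) (V : set X)
    (u : X -> R[i]) : form1 X := fun a x =>
  if `[< V x /\ cdom a x >] then \col_k ((u x)^-1 * pder a k u x) else 0.

Section DLog.
Variable R : realType.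
Local Notation C := R[i].
Variables (n : nat) (X : cmanifold R n).
Implicit Types (V W : set X) (u h : X -> C) (a b : catlas X) (x : X).

Local Notation chart u a := (u \o @cinv R n X a).

(** Near [cmap a x] the chart is invertible and its inverse stays in [V], so
    identities between functions on [V] may be differentiated in the chart. *)
Lemma near_chart V a x : open V -> V x -> cdom a x ->
  \forall z \near cmap a x, [/\ V (cinv a z), cdom a (cinv a z) & cmap a (cinv a z) = z].
Proof.
move=> oV Vx ax.
have N1 : \forall z \near cmap a x, V (cinv a z).
  apply: (cinv_continuous ax); rewrite /= cmapK //.
  by apply: open_nbhs_nbhs; split.
have N2 : \forall z \near cmap a x, (cmap a @` cdom a) z.
  by apply: open_nbhs_nbhs; split; [exact: cimg_open|exists x].
apply: filterS2 N1 N2 => z Vz [y ay yz].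
by move: Vz; rewrite -yz cmapK.
Qed.

Lemma near_holo V (Y : normedModType C) (F : X -> Y) a x :
  open V -> holo_fun V F -> V x -> cdom a x ->
  \forall z \near cmap a x, differentiable (F \o cinv a) z.
Proof.
move=> oV hF Vx ax; apply: filterS (near_chart oV Vx ax) => z [Vz az zE].
by have := hF a _ Vz az; rewrite zE.
Qed.

Lemma dlogE V u a x : V x -> cdom a x -> dlog V u a x = \col_k ((u x)^-1 * pder a k u x).
Proof. by move=> Vx ax; rewrite dlog.unlock asboolT. Qed.

Lemma dlog_out V u a x : ~ (V x /\ cdom a x) -> dlog V u a x = 0.
Proof. by move=> h; rewrite dlog.unlock asboolF. Qed.

Lemma dlog_entry V u a x k : V x -> cdom a x -> dlog V u a x k 0 = (u x)^-1 * pder a k u x.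
Proof. by move=> Vx ax; rewrite dlogE // mxE. Qed.

Lemma holo_entry V m1 m2 (F : X -> 'M[C]_(m1, m2)) i j :
  holo_fun V F -> holo_fun V (fun x => F x i j).
Proof.
move=> hF a x Vx ax.
apply: (@differentiable_comp C 'rV[C]_n 'M[C]_(m1, m2) C (F \o cinv a) (fun A => A i j)).
  exact: hF.
exact: differentiable_coord.
Qed.

(** h^-1 = (det h)^-1 adj h, and tr(adj h dh) = d(det h) by Jacobi's formula. *)
Lemma tr_dlog_det V M (F : X -> 'M[C]_M) : open V -> holo_fun V F ->
  (forall x, V x -> F x \in unitmx) ->
  holo_fun V (fun x => \det (F x)) /\ tr_dlog V F = dlog V (fun x => \det (F x)).
Proof.
move=> oV hF uF.
have J a x (Vx : V x) (ax : cdom a x) :=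
  @jacobi_formula R 'rV[C]_n M (F \o cinv a) (cmap a x)
    (fun i j => holo_entry i j hF Vx ax).
split; first by move=> a x Vx ax; have [] := J a x Vx ax.
apply/funext => a; apply/funext => x; rewrite /tr_dlog.
case: asboolP => [[Vx ax]|o]; last by rewrite dlog_out.
have [_ D] := J a x Vx ax.
apply/colP => k; rewrite dlog_entry // mxE /pder [X in _ = _ * X]D /= cmapK //.
by rewrite /invmx uF // -scalemxAl mxtraceZ.
Qed.

Lemma pder_near a k u h x : (\forall z \near cmap a x, u (cinv a z) = h (cinv a z)) ->
  pder a k u x = pder a k h x.
Proof. by move=> uh; apply: near_eq_derive; exact: uh. Qed.

Lemma eq_dlog V u h : open V -> (forall x, V x -> u x = h x) -> dlog V u = dlog V h.
Proof.
move=> oV uh; apply/funext => a; apply/funext => x.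
have [[Vx ax]|o] := pselect (V x /\ cdom a x); last by rewrite !dlog_out.
apply/colP => k; apply: etrans (dlog_entry u k Vx ax) _.
apply: etrans _ (esym (dlog_entry h k Vx ax)).
suff -> : pder a k u x = pder a k h x by rewrite (uh x Vx).
apply: pder_near.
by apply: filterS (near_chart oV Vx ax) => z [/uh].
Qed.

Lemma dlogM V u h : open V -> holo_fun V u -> holo_fun V h ->
  (forall x, V x -> u x != 0) -> (forall x, V x -> h x != 0) ->
  dlog V (fun x => u x * h x) = dlog V u + dlog V h.
Proof.
move=> oV du dh u0 h0; apply/funext => a; apply/funext => x.
rewrite [RHS](_ : _ = dlog V u a x + dlog V h a x) //.
have [[Vx ax]|o] := pselect (V x /\ cdom a x); last by rewrite !dlog_out // addr0.
apply/colP => k; rewrite [RHS]mxE; apply: etrans (dlog_entry _ k Vx ax) _.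
apply: etrans _ (esym (congr2 +%R (dlog_entry u k Vx ax) (dlog_entry h k Vx ax))).
have e : cinv a (cmap a x) = x := cmapK ax.
have E : pder a k (fun x => u x * h x) x = u x * pder a k h x + h x * pder a k u x.
  apply: etrans (deriveC_M (delta_mx 0 k) (du a x Vx ax) (dh a x Vx ax)) _.
  exact: (congr1 (fun y => u y * pder a k h x + h y * pder a k u x) e).
apply: (etrans (congr1 (fun z => (u x * h x)^-1 * z) E)).
move: (u0 x Vx) (h0 x Vx); generalize (u x) (h x) (pder a k u x) (pder a k h x).
by move=> ? ? ? ? ? ?; field; apply/andP.
Qed.

Lemma dlog1 V : dlog V (fun=> 1) = 0.
Proof.
apply/funext => a; apply/funext => x.
have [[Vx ax]|o] := pselect (V x /\ cdom a x); last by rewrite dlog_out.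
apply/colP => k; rewrite dlog_entry // [RHS]mxE (_ : pder a k _ x = 0) ?mulr0 //.
exact: derive_cst.
Qed.

Lemma cutoff_dlog V W u : W `<=` V -> cutoff W (dlog V u) = dlog W u.
Proof.
move=> WV; apply/funext => a; apply/funext => x; rewrite /cutoff.
case: asboolP => [Wx|nWx]; last by rewrite dlog_out // => -[].
have [ax|ax] := pselect (cdom a x); last by rewrite !dlog_out // => -[].
by rewrite !dlogE //; exact: WV.
Qed.

Lemma differentiable_col m (Y : normedModType C) (F : Y -> 'cV[C]_m) p :
  (forall k, differentiable (fun y => F y k 0) p) -> differentiable F p.
Proof.
move=> dF.
rewrite (_ : F = \sum_k (fun y => F y k 0 *: delta_mx k 0)).
  apply: differentiable_sum => k.
  exact: (@differentiableZl C Y 'cV[C]_m (fun y => F y k 0)).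
apply/funext => y; rewrite fct_sumE [LHS]matrix_sum_delta; apply: eq_bigr => k _.
by rewrite big_ord1.
Qed.

(** Compatibility of the charts is the chain rule. Holomorphy of the coefficients
    rests on [differentiable_derive]. *)
Lemma dlog_Omega1 V u : open V -> holo_fun V u -> (forall x, V x -> u x != 0) ->
  Omega1 V (dlog V u).
Proof.
move=> oV du u0; split.
- exact: dlog_out.
- move=> a b x Vx ax bx; rewrite !dlogE //.
  have dab := ctrans_holo ax bx.
  have dub := du b x Vx bx.
  have E : \forall z \near cmap a x, (chart u b \o (cmap b \o cinv a)) z = chart u a z.
    have N := near_chart (cdom_open b) bx ax.
    by apply: filterS N => z [bz _ _] /=; rewrite cmapK.
  have e : (cmap b \o cinv a) (cmap a x) = cmap b x := congr1 (cmap b) (cmapK ax).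
  have dub' : differentiable (chart u b) ((cmap b \o cinv a) (cmap a x)).
    by rewrite e.
  have rowJ k : 'd (cmap b \o cinv a) (cmap a x) (delta_mx 0 k) =
      \row_l jacobian (cmap b \o cinv a) (cmap a x) k l.
    apply: etrans (esym (deriveE _ dab)) _; apply: etrans (deriveEjacobian _ dab) _.
    by apply: etrans (esym (rowE _ _)) _; apply/rowP => l; rewrite [LHS]mxE [RHS]mxE.
  have chain k : pder a k u x =
      \sum_l jacobian (cmap b \o cinv a) (cmap a x) k l * pder b l u x.
    apply: etrans (esym (near_eq_derive (delta_mx 0 k) E)) _.
    apply: etrans (deriveE _ (differentiable_comp dab dub')) _.
    apply: etrans (congr1 (fun F => F (delta_mx 0 k)) (diff_comp dab dub')) _.
    apply: etrans (congr1 ('d (chart u b) ((cmap b \o cinv a) (cmap a x))) (rowJ k)) _.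
    apply: etrans (congr1 (fun y => 'd (chart u b) y
      (\row_l jacobian (cmap b \o cinv a) (cmap a x) k l)) e) _.
    rewrite (row_sum_delta (\row_l _)) raddf_sum; apply: eq_bigr => l _.
    rewrite mxE; apply: etrans (linearZ_LR ('d (chart u b) (cmap b x)) _ _) _.
    exact: (congr1 (fun z => _ * z) (esym (deriveE _ dub))).
  apply/colP => k; rewrite mxE [RHS]mxE chain mulr_sumr; apply: eq_bigr => l _.
  by rewrite [X in _ = _ * X]mxE; exact: mulrCA.
- move=> a x Vx ax; apply: differentiable_col => k.
  have dn := near_holo oV du Vx ax.
  have dk := differentiable_derive (delta_mx 0 k) dn.
  have dV : differentiable (fun z => (u (cinv a z))^-1) (cmap a x).
    by apply: (differentiableC_V (nbhs_singleton dn)); rewrite /= cmapK // u0.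
  have D := differentiableC_M dV dk.
  have N : \forall z \near cmap a x,
      (u (cinv a z))^-1 * 'D_(delta_mx 0 k) (chart u a) z = (dlog V u a \o cinv a) z k 0.
    apply: filterS (near_chart oV Vx ax) => z [Vz az zE].
    apply: etrans _ (esym (dlog_entry u k Vz az)).
    exact: (congr1 (fun y => _ * 'D_(delta_mx 0 k) (chart u a) y) (esym zE)).
  by have [] := Defs.near_eq_diff N D.
Qed.

Let dlog_second_algebra (w d s t : C) :
  w * d + t * (- w ^+ 2 * s) = w * d - w ^+ 2 * (s * t).
Proof. by ring. Qed.

(** d_k (d_l u / u) = d_k d_l u / u - d_k u d_l u / u^2 is symmetric in k and
    l. *)
Lemma dlog_closed V u : open V -> holo_fun V u -> (forall x, V x -> u x != 0) ->
  dOmega0 V (dlog V u).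
Proof.
move=> oV du u0; split; first exact: dlog_Omega1.
move=> a x Vx ax; apply/matrixP => k l.
have dn := near_holo oV du Vx ax.
have d0 := nbhs_singleton dn.
have ux : u (cinv a (cmap a x)) != 0 by rewrite cmapK // u0.
have dV : differentiable (fun z => (u (cinv a z))^-1) (cmap a x) by exact: differentiableC_V d0 ux.
have dk i := differentiable_derive (delta_mx 0 i) dn.
have E i j : pder a i (fun y => dlog V u a y j 0) x =
   (u x)^-1 * 'D_(delta_mx 0 i) (fun z => 'D_(delta_mx 0 j) (chart u a) z) (cmap a x) -
   (u x)^-1 ^+ 2 * (pder a i u x * pder a j u x).
  have N : \forall z \near cmap a x, (fun y => dlog V u a y j 0) (cinv a z) =
     (u (cinv a z))^-1 * 'D_(delta_mx 0 j) (chart u a) z.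
    apply: filterS (near_chart oV Vx ax) => z [Vz az zE].
    apply: etrans (dlog_entry u j Vz az) _.
    exact: (congr1 (fun y => _ * 'D_(delta_mx 0 j) (chart u a) y) zE).
  apply: etrans (near_eq_derive _ N) _; apply: etrans (deriveC_M _ dV (dk j)) _.
  apply: etrans (congr1 (fun y => _ + _ * y) (deriveC_V _ d0 ux)) _.
  apply: etrans (congr1 (fun y => (u y)^-1 * _ + _ * (- (u y)^-1 ^+ 2 * _)) (cmapK ax)) _.
  exact: dlog_second_algebra.
have S := derive_sym (delta_mx 0 k) (delta_mx 0 l) dn.
rewrite mxE [RHS]mxE; apply: (etrans (congr2 (fun y z => y - z) (E k l) (E l k))).
rewrite [X in _ - (_ - _ * X)]mulrC; apply/eqP; rewrite subr_eq0; apply/eqP.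
exact: (congr1 (fun y => _ * y - _) S).
Qed.

End DLog.

(** * Changes of trivialization *)
Section Trivializations.
Variable R : realType.
Local Notation C := R[i].
Variables (n : nat) (X : cmanifold R n) (M : nat) (E : fiber_family X M).
Implicit Types (V W : set X) (phi : E -> 'cV[C]_M) (p : E) (x : X).

Lemma is_trivialization_sub V W phi : W `<=` V ->
  is_trivialization V phi -> is_trivialization W phi.
Proof.
move=> WV [lin hol [psi [psiK phiK hpsi]]]; split.
- by move=> x /WV; exact: lin.
- by move=> a p Vp; apply: hol; exact: WV.
- by exists psi; split=> [x v /WV|p /WV|x v /WV]; [exact: psiK|exact: phiK|exact: hpsi].
Qed.

Lemma trivialization_surj V phi x (v : 'cV[C]_M) : is_trivialization V phi -> V x ->
  exists p, bproj p = x /\ phi p = v.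
Proof. by move=> [_ _ [psi [psiK _ _]]] Vx; exists (psi (x, v)); exact: psiK. Qed.

Lemma mulmx_cV_inj m1 m2 (A B : 'M[C]_(m1, m2)) : (forall v : 'cV_m2, A *m v = B *m v) -> A = B.
Proof.
move=> AB; apply/matrixP => i j.
by have := congr1 (fun w : 'cV_m1 => w i 0) (AB (delta_mx j 0)); rewrite -!colE !mxE.
Qed.

Lemma fiber_point p x : bproj p = x -> exists v : fib E x, pt v = p.
Proof. by move=> <-; exact: pt_surj. Qed.

Lemma linear_combination (L : lmodType C) m (f : L -> 'cV[C]_m) k (c : 'I_k -> C) (w : 'I_k -> L) :
  linear f -> f (\sum_j c j *: w j) = \sum_j c j *: f (w j).
Proof.
move=> lf.
have f0 : f 0 = 0.
  have := lf 1 0 0; rewrite scaler0 addr0 scale1r => /esym/eqP.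
  by rewrite -subr_eq0 addrK => /eqP.
elim/big_rec2: _ => // j y z _ <-; exact: lf.
Qed.

(** The matrix whose c-th column is the image under [phi] of the frame element
    psi(x, e_c). When [psi] inverts a trivialization phi0, this is the matrix of
    [phi] composed with the inverse of phi0. *)
Definition change_of_trivialization (psi : X * 'cV[C]_M -> E) phi x : 'M[C]_M :=
  \matrix_(r, c) phi (psi (x, delta_mx c 0)) r 0.

(** A point of the fiber is the combination of the frame psi(x, e_c) with its
    phi-coordinates as coefficients, because both have the same image under the
    injective map [phi]; apply the linear map [phi']. *)
Lemma change_of_trivializationP V phi psi phi' : is_trivialization V phi ->
  (forall x v, V x -> bproj (psi (x, v)) = x /\ phi (psi (x, v)) = v) ->
  (forall p, V (bproj p) -> psi (bproj p, phi p) = p) ->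
  is_trivialization V phi' ->
  forall p, V (bproj p) -> phi' p = change_of_trivialization psi phi' (bproj p) *m phi p.
Proof.
move=> [lin _ _] psiK phiK [lin' _ _] p Vp.
set x := bproj p in Vp *.
have W c : exists w : fib E x, pt w = psi (x, delta_mx c 0).
  by apply: fiber_point; have [] := psiK x (delta_mx c 0) Vp.
have [w wE] := choice W.
have [v vE] := pt_surj p.
pose s := \sum_c phi p c 0 *: w c.
have phis : phi (pt s) = phi p.
  rewrite (linear_combination _ _ (lin x Vp)) [RHS]matrix_sum_delta.
  apply: eq_bigr => c _; rewrite big_ord1 wE.
  by have [_ ->] := psiK x (delta_mx c 0) Vp.
have ps : pt s = p.
  have xs : bproj (pt s) = x by exact: proj_pt.
  rewrite -[RHS]phiK // -/x -[LHS]phiK ?xs // phis //.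
rewrite -{1}ps (linear_combination _ _ (lin' x Vp)).
set A := change_of_trivialization _ _ _.
apply/colP => r; rewrite summxE mxE; apply: eq_bigr => c _.
by rewrite !mxE wE mulrC.
Qed.

(** Each entry is a composite of [phi'], read in a chart of the total space around
    psi(x, e_j), and of the holomorphic map z |-> psi(z, e_j). *)
Lemma differentiable_change V phi psi phi' : open V ->
  (forall x v, V x -> bproj (psi (x, v)) = x /\ phi (psi (x, v)) = v) ->
  holo_map_prod V psi -> is_trivialization V phi' ->
  holo_fun V (fun x => \det (change_of_trivialization psi phi' x)).
Proof.
move=> oV psiK hpsi [_ hphi' _] a x Vx ax.
suff D i j : differentiable
    ((fun x => change_of_trivialization psi phi' x i j) \o cinv a) (cmap a x).
  by have [] := @jacobi_formula R 'rV[C]_n M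
    (change_of_trivialization psi phi' \o cinv a) (cmap a x) D.
set v : 'cV[C]_M := delta_mx j 0.
have [b bx] := cdom_cover (psi (x, v)).
have [cpsi dpsi] := hpsi x v Vx.
have {}dpsi := dpsi a b ax bx.
have e : cinv a (cmap a x) = x := cmapK ax.
have dpair : differentiable (fun z : 'rV[C]_n => (z, v)) (cmap a x).
  by apply: differentiable_pair; [exact: ex_diff|exact: differentiable_cst].
have din : differentiable (fun z : 'rV[C]_n => cmap b (psi (cinv a z, v))) (cmap a x).
  exact: (differentiable_comp dpair dpsi).
have Vp : V (bproj (psi (x, v))) by have [-> _] := psiK x v Vx.
have dout : differentiable (phi' \o cinv b) (cmap b (psi (cinv a (cmap a x), v))).
  by rewrite e; exact: hphi'.
have dcoord := differentiable_comp (differentiable_comp din dout)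
  (differentiable_coord (R := C) _ i (0 : 'I_1)).
have N : \forall z \near cmap a x, cdom b (psi (cinv a z, v)).
  have cz : {for cmap a x, continuous (fun z => psi (cinv a z, v))}.
    apply: (@continuous_comp _ _ _ (fun z => (cinv a z, v)) psi); last by rewrite e.
    have FF : Filter (nbhs (cmap a x)) by exact: nbhs_filter.
    exact: (cvg_pair (FF := FF) (cinv_continuous ax) (@cst_continuous _ _ v (cmap a x))).
  apply: cz; rewrite /= e; apply: open_nbhs_nbhs; split => //; exact: cdom_open.
have N' : \forall z \near cmap a x,
    (phi' \o cinv b) (cmap b (psi (cinv a z, v))) i 0 =
    change_of_trivialization psi phi' (cinv a z) i j.
  by apply: filterS N => z bz; rewrite /= cmapK // mxE.
by have [] := Defs.near_eq_diff N' dcoord.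
Qed.

End Trivializations.

(** * The cocycle of a system of transition functions *)
Lemma sum_S2 (V : nmodType) (F : 'S_2 -> V) :
  \sum_(s : 'S_2) F s = F 1%g + F (tperm ord0 ord_max).
Proof.
have t1 : tperm ord0 ord_max != 1%g :> 'S_2.
  by apply/eqP => /permP/(_ ord0); rewrite tpermL perm1.
rewrite (bigD1 1%g) //= (bigD1 (tperm ord0 ord_max)) //= big1 ?addr0 // => s /andP[s1 st].
exfalso.
have I2 (i : 'I_2) : i = ord0 \/ i = ord_max.
  by case: i => [[|[|//]] ?]; [left|right]; apply: val_inj.
have sI := @perm_inj _ s.
have [s0|s0] := I2 (s ord0); have [s0'|s0'] := I2 (s ord_max).
- by have := sI ord0 ord_max; rewrite s0 s0' => /(_ erefl).
- case/negP: s1; apply/eqP/permP => i; rewrite perm1.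
  by have [->|->] := I2 i.
- case/negP: st; apply/eqP/permP => i.
  by have [->|->] := I2 i; rewrite ?tpermL ?tpermR.
- by have := sI ord0 ord_max; rewrite s0 s0' => /(_ erefl).
Qed.

Section TransitionSystems.
Variable R : realType.
Local Notation C := R[i].
Variables (n : nat) (X : cmanifold R n) (M : nat) (E : vbundle X M).
Local Notation opens := (Defs.opens X).
Local Notation open_cover := (Defs.open_cover X).

Section OneSystem.
Variables (U : open_cover) (g : cidx U -> cidx U -> X -> 'M[C]_M).
Hypothesis hg : transition_system E g.
Implicit Types i j k : cidx U.

Let u i j x : C := \det (g i j x).

(** Both sides send phi_k(p) to phi_i(p) for all points [p] over [x], and
    phi_k is onto on fibers. *)
Lemma transition_cocycle i j k x : (U i : set X) x -> (U j : set X) x -> (U k : set X) x ->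
  g i k x = g i j x *m g j k x.
Proof.
move=> ix jx kx; have [phi [tr H]] := hg.
apply: mulmx_cV_inj => v; have [p [px <-]] := trivialization_surj v (tr k) kx.
have G i' j' : (U i' : set X) x -> (U j' : set X) x -> phi i' p = g i' j' x *m phi j' p.
  by move=> i'x j'x; have [_ _ ->] := H i' j'; rewrite px.
by rewrite -mulmxA -!G.
Qed.

Lemma transition_det_neq0 i j x : (U i `&` U j) x -> u i j x != 0.
Proof.
move=> ijx; have [phi [_ H]] := hg; have [_ gu _] := H i j.
by have := gu x ijx; rewrite unitmxE unitfE.
Qed.

Lemma transition_det i j k x : (U i : set X) x -> (U j : set X) x -> (U k : set X) x ->
  u i k x = u i j x * u j k x.
Proof. by move=> ix jx kx; rewrite /u (transition_cocycle ix jx kx) det_mulmx. Qed.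

Lemma transition_det_refl i x : (U i : set X) x -> u i i x = 1.
Proof.
move=> ix; have := transition_det ix ix ix; have := @transition_det_neq0 i i x (conj ix ix).
by move=> n0 /esym; rewrite -[X in _ = X]mulr1 => /(mulfI n0).
Qed.

Lemma transition_det_holo i j : holo_fun (U i `&` U j) (u i j) /\
  tr_dlog (U i `&` U j) (g i j) = dlog (U i `&` U j) (u i j).
Proof.
have [phi [_ H]] := hg; have [gh gu _] := H i j.
exact: tr_dlog_det (oset_open (oI (U i) (U j))) gh gu.
Qed.

Lemma holo_fun_sub (Y : normedModType C) (V W : set X) (F : X -> Y) :
  W `<=` V -> holo_fun V F -> holo_fun W F.
Proof. by move=> WV hF a x /WV; exact: hF. Qed.

Lemma dlog_cocycle (W : opens) i j k :
  ole W (U i) -> ole W (U j) -> ole W (U k) ->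
  dlog W (u i k) = dlog W (u i j) + dlog W (u j k).
Proof.
move=> Wi Wj Wk; rewrite -dlogM.
- apply: eq_dlog; first exact: oset_open.
  by move=> x Wx; apply: transition_det; [exact: Wi|exact: Wj|exact: Wk].
- exact: oset_open.
- by apply: holo_fun_sub (transition_det_holo i j).1 => x Wx; split; [exact: Wi|exact: Wj].
- by apply: holo_fun_sub (transition_det_holo j k).1 => x Wx; split; [exact: Wj|exact: Wk].
- by move=> x Wx; apply: transition_det_neq0; split; [exact: Wi|exact: Wj].
- by move=> x Wx; apply: transition_det_neq0; split; [exact: Wj|exact: Wk].
Qed.

Lemma dlog_refl (W : opens) i : ole W (U i) -> dlog W (u i i) = 0.
Proof.
move=> Wi; rewrite -(dlog1 W).
by apply: eq_dlog; [exact: oset_open|move=> x Wx; apply: transition_det_refl; exact: Wi].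
Qed.

Lemma dlog_anti (W : opens) i j : ole W (U i) -> ole W (U j) ->
  dlog W (u j i) = - dlog W (u i j).
Proof.
move=> Wi Wj; apply/eqP; rewrite -addr_eq0 addrC; apply/eqP.
by rewrite -(dlog_cocycle Wi Wj Wi) dlog_refl.
Qed.

(** The transposition contributes - tr(g_ji^-1 dg_ji) / 2, and
    tr(g_ji^-1 dg_ji) = - tr(g_ij^-1 dg_ij) because det g_ij det g_ji = 1. *)
Lemma t_form_tr_dlog i j : t_form g i j = tr_dlog (U i `&` U j) (g i j).
Proof.
rewrite /t_form sum_S2 odd_perm1 odd_tperm /= !perm1 tpermL tpermR.
rewrite !(tnth_nth i) /= expr0 expr1.
have e1 := (transition_det_holo i j).2.
have e2 : tr_dlog (U i `&` U j) (g j i) = - dlog (U i `&` U j) (u i j).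
  rewrite -(dlog_anti (W := oI (U i) (U j)) (oleIl _ _) (oleIr _ _)).
  by rewrite [X in tr_dlog X]setIC (transition_det_holo j i).2 [in LHS]setIC.
rewrite e1 e2 scalerN -scaleNr -mulNr opprK -scalerDl.
by rewrite -mulrDl -mulr2n divff ?scale1r // pnatr_eq0.
Qed.

Lemma t_formE i j : t_form g i j = dlog (U i `&` U j) (u i j).
Proof. by rewrite t_form_tr_dlog; exact: (transition_det_holo i j).2. Qed.

Lemma t_form_closed i j : dOmega0 (U i `&` U j) (t_form g i j).
Proof.
rewrite t_formE; apply: dlog_closed.
- exact: (oset_open (oI (U i) (U j))).
- exact: (transition_det_holo i j).1.
- by move=> x; exact: transition_det_neq0.
Qed.

Lemma f1r_cochainE i j (ij : clt i j) :
  form_of (f1r_cochain g ij) = dlog (oI (U i) (U j)) (u i j).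
Proof.
rewrite -[RHS]t_formE; apply: insubdK.
by apply/asboolP; exact: t_form_closed.
Qed.

Lemma f1r_cochain_cocycle : del1 (f1r_cochain g) = 0.
Proof.
apply: functional_extensionality_dep => i.
apply: functional_extensionality_dep => j.
apply: functional_extensionality_dep => k.
apply: functional_extensionality_dep => ij.
apply: functional_extensionality_dep => jk.
set W := oI (oI (U i) (U j)) (U k).
have Wi : ole W (U i) by move=> x [[]].
have Wj : ole W (U j) by move=> x [[]].
have Wk : ole W (U k) by move=> x [].
apply: val_inj.
transitivity (cutoff W (form_of (f1r_cochain g jk)) -
  cutoff W (form_of (f1r_cochain g (clt_trans ij jk))) +
  cutoff W (form_of (f1r_cochain g ij))); first by [].
rewrite !f1r_cochainE !cutoff_dlog; [|exact: oleI..].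
by rewrite (dlog_cocycle Wi Wj Wk) opprD addrCA subrr addr0 addNr.
Qed.

Lemma f1r_cocycle_in : f1r_cochain g \in @is_cocycle1 _ (dOmega0_sheaf X) U.
Proof. by rewrite unfold_in /=; apply/eqP; exact: f1r_cochain_cocycle. Qed.

Lemma f1r_coverE : f1r_cover g = cech_class (Cocycle1 f1r_cocycle_in).
Proof. by congr cech_class; apply: val_inj; exact: insubdK f1r_cocycle_in. Qed.

(** The alternating extension of the cochain is given by the same formula for all
    pairs of indices, which is what a refinement map that is not increasing
    requires. *)
Lemma alt_f1r_cochain i j :
  form_of (alt (f1r_cochain g) i j) = dlog (oI (U i) (U j)) (u i j).
Proof.
have [ij|ji|ij] := clt_total i j.
- by rewrite (alt_lt _ ij) f1r_cochainE.
- rewrite (alt_gt _ ji).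
  transitivity (- cutoff (oI (U i) (U j)) (form_of (f1r_cochain g ji))); first by [].
  rewrite f1r_cochainE cutoff_dlog; last exact: oleC.
  by rewrite (dlog_anti (oleIl _ _) (oleIr _ _)) opprK.
- by subst j; rewrite alt_refl dlog_refl //; exact: oleIl.
Qed.

End OneSystem.

Lemma transition_system_refine (U W : open_cover) (r : refinement W U)
    (g : cidx U -> cidx U -> X -> 'M[C]_M) :
  transition_system E g -> transition_system E (fun i j : cidx W => g (r i) (r j)).
Proof.
move=> [phi [tr H]]; exists (fun i => phi (r i)); split=> [i|i j].
  by apply: is_trivialization_sub (tr (r i)); exact: rmapP.
have S : W i `&` W j `<=` U (r i) `&` U (r j).
  by move=> x [ix jx]; split; exact: rmapP.
have [gh gu gp] := H (r i) (r j); split.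
- exact: holo_fun_sub S gh.
- by move=> x /S; exact: gu.
- by move=> p /S; exact: gp.
Qed.

Lemma refineH1_f1r_cover (U W : open_cover) (r : refinement W U)
    (g : cidx U -> cidx U -> X -> 'M[C]_M) (hg : transition_system E g) :
  refineH1 r (f1r_cover g) = f1r_cover (fun i j : cidx W => g (r i) (r j)).
Proof.
have hg' := transition_system_refine r hg.
rewrite (f1r_coverE hg) (f1r_coverE hg') refineH1E; congr cech_class; apply: val_inj.
apply: functional_extensionality_dep => i.
apply: functional_extensionality_dep => j.
apply: functional_extensionality_dep => ij.
apply: val_inj.
transitivity (cutoff (oI (W i) (W j)) (form_of (alt (f1r_cochain g) (r i) (r j)))); first by [].
rewrite (alt_f1r_cochain hg) cutoff_dlog; last by move=> x [ix jx]; split; exact: rmapP.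
by rewrite [RHS](f1r_cochainE hg').
Qed.

Section TwoSystems.
Variables (U : open_cover) (g g' : cidx U -> cidx U -> X -> 'M[C]_M).
Hypotheses (hg : transition_system E g) (hg' : transition_system E g').

(** The functions l_i are the determinants of the changes of trivialization
    phi'_i phi_i^-1. *)
Lemma change_of_systems : exists l : cidx U -> X -> C,
  [/\ forall i, holo_fun (U i) (l i),
      forall i x, (U i : set X) x -> l i x != 0
    & forall i j x, (U i : set X) x -> (U j : set X) x ->
        \det (g' i j x) * l j x = l i x * \det (g i j x)].
Proof.
have [phi [tr H]] := hg; have [phi' [tr' H']] := hg'.
have P i : exists A : X -> 'M[C]_M,
   [/\ holo_fun (U i) (fun x => \det (A x)), forall x, (U i : set X) x -> \det (A x) != 0
     & forall p, (U i : set X) (bproj p) -> phi' i p = A (bproj p) *m phi i p].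
  have [_ _ [psi [psiK phiK hpsi]]] := tr i.
  have [_ _ [psi' [psiK' phiK' _]]] := tr' i.
  have A := change_of_trivializationP (tr i) psiK phiK (tr' i).
  have B := change_of_trivializationP (tr' i) psiK' phiK' (tr i).
  exists (change_of_trivialization psi (phi' i)); split => //.
    exact: differentiable_change (oset_open (U i)) psiK hpsi (tr' i).
  move=> x Ux; rewrite -unitfE -unitmxE.
  suff AB : change_of_trivialization psi (phi' i) x *m
      change_of_trivialization psi' (phi i) x = 1%:M.
    by have [] := mulmx1_unit AB.
  apply: mulmx_cV_inj => v; have [p [px <-]] := trivialization_surj v (tr' i) Ux.
  have Up : (U i : set X) (bproj p) by rewrite px.
  by rewrite mul1mx -mulmxA -px -B // -A.
have [A AP] := choice P.
exists (fun i x => \det (A i x)); split=> [i|i|i j x ix jx];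
  [by have [] := AP i|by have [] := AP i|].
rewrite -!det_mulmx; congr (\det _).
apply: mulmx_cV_inj => v; have [p [px <-]] := trivialization_surj v (tr j) jx.
have [_ _ Ai] := AP i; have [_ _ Aj] := AP j.
have [_ _ G] := H i j; have [_ _ G'] := H' i j.
have ijx : (U i `&` U j) (bproj p) by rewrite px.
have [ip jp] := ijx.
by rewrite -!mulmxA -px -(Aj p jp) -(G p ijx) -(Ai p ip) (G' p ijx).
Qed.

(** The relation det g'_ij l_j = l_i det g_ij gives
    t'_ij - t_ij = dl_i/l_i - dl_j/l_j, the coboundary of the 0-cochain
    - dl_i/l_i. *)
Lemma f1r_cover_indep : f1r_cover g' = f1r_cover g.
Proof.
have [l [lh l0 lg]] := change_of_systems.
rewrite (f1r_coverE hg) (f1r_coverE hg'); apply/cech_classP.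
have cl i : - dlog (U i) (l i) \in in_dOmega0 (U i).
  rewrite rpredN; apply/asboolP; apply: dlog_closed.
  - exact: oset_open.
  - exact: lh.
  - exact: l0.
exists (fun i => ClosedForm (cl i)).
apply: functional_extensionality_dep => i.
apply: functional_extensionality_dep => j.
apply: functional_extensionality_dep => ij.
apply: val_inj; set W := oI (U i) (U j).
transitivity (form_of (f1r_cochain g' ij) - form_of (f1r_cochain g ij)); first by [].
transitivity (cutoff W (- dlog (U j) (l j)) - cutoff W (- dlog (U i) (l i))); last by [].
have cN (V : opens) (w : form1 X) : cutoff V (- w) = - cutoff V w.
  apply/funext => a; apply/funext => x; rewrite /cutoff !fctE.
  by case: asboolP => // _; rewrite oppr0.
have Wi : ole W (U i) by exact: oleIl.
have Wj : ole W (U j) by exact: oleIr.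
have oW : open (W : set X) by exact: oset_open.
have lhi := holo_fun_sub Wi (lh i); have lhj := holo_fun_sub Wj (lh j).
have l0i x : (W : set X) x -> l i x != 0 by move=> /Wi; exact: l0.
have l0j x : (W : set X) x -> l j x != 0 by move=> /Wj; exact: l0.
have E1 : dlog W (fun x => \det (g' i j x)) + dlog W (l j) =
          dlog W (l i) + dlog W (fun x => \det (g i j x)).
  rewrite -!dlogM //.
  - by apply: eq_dlog => // x Wx; apply: lg; [exact: Wi|exact: Wj].
  - exact: (transition_det_holo hg i j).1.
  - by move=> x; exact: transition_det_neq0.
  - exact: (transition_det_holo hg' i j).1.
  - by move=> x; exact: transition_det_neq0.
have ci : cutoff W (- dlog (U i) (l i)) = - dlog W (l i) by rewrite cN cutoff_dlog.
have cj : cutoff W (- dlog (U j) (l j)) = - dlog W (l j) by rewrite cN cutoff_dlog.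
apply: etrans (congr2 (fun y z => y - z) (f1r_cochainE hg' ij) (f1r_cochainE hg ij)) _.
apply: etrans _ (esym (congr2 (fun y z => y - z) cj ci)).
apply/eqP; rewrite opprK subr_eq -addrA -E1 addrC addrK.
exact: eqxx.
Qed.

End TwoSystems.

End TransitionSystems.

Theorem theorem1p8 (R : realType) (n : nat) (X : cmanifold R n) (M : nat)
    (E : vbundle X M) (U : open_cover X) (g : cidx U -> cidx U -> X -> 'M[R[i]]_M)
    (hg : transition_system E g) :
  [/\ forall i1 i2 : cidx U,
        t_form g i1 i2 = tr_dlog (U i1 `&` U i2) (g i1 i2),
      forall i1 i2 : cidx U, dOmega0 (U i1 `&` U i2) (t_form g i1 i2),
      del1 (f1r_cochain g) = 0,
      forall g' : cidx U -> cidx U -> X -> 'M[R[i]]_M,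
        transition_system E g' -> f1r_cover g' = f1r_cover g
    & forall (U' : open_cover X) (g' : cidx U' -> cidx U' -> X -> 'M[R[i]]_M),
        transition_system E g' -> f1r g' = f1r g].
Proof.
split.
- exact: t_form_tr_dlog hg.
- exact: t_form_closed hg.
- exact: f1r_cochain_cocycle hg.
- by move=> g' hg'; exact: f1r_cover_indep hg hg'.
move=> U' g' hg'; apply/to_limH1P.
exists (common_refinement U' U), (refine_l U' U), (refine_r U' U).
rewrite (refineH1_f1r_cover _ hg') (refineH1_f1r_cover _ hg).
exact: f1r_cover_indep (transition_system_refine _ hg) (transition_system_refine _ hg').
Qed.
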